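(* Let $\theta\in[0,1[$ be irrational, let $M\ge 1$ be an integer and let $n\in\{1,2,\ldots,\tfrac12 M(M+1)\}$. Suppose that $0<\theta<1/\max(n,M)$. Then there exists a projection of order $M$ in $\mathcal{A}_\theta$ representing the class $[n\theta]\in K_0(\mathcal{A}_\theta)$ (i.e. with trace $\tau(p)=n\theta$), and there exists a projection of order $M$ in $\mathcal{A}_\theta$ representing the class $[1-n\theta]\in K_0(\mathcal{A}_\theta)$ (i.e. with trace $\tau(p)=1-n\theta$).
   Context: For irrational $\theta\in[0,1[$, $A_\theta$ is the universal $C^*$-algebra generated by two unitaries $U,V$ with $VU=e^{2\pi i\theta}UV$ (the noncommutative 2-torus). $\mathcal{A}_\theta\subset A_\theta$ is the dense $*$-subalgebra of elements $\sum_{(m,n)\in\mathbb{Z}^2}a_{m,n}U^mV^n$ with $\{a_{m,n}\}$ a Schwartz (rapidly decreasing) sequence on $\mathbb{Z}^2$. For $f\in C^\infty(\mathbb{R}/\mathbb{Z})$ with Fourier series $f(x)=\sum_{n\in\mathbb{Z}}f_ne^{2\pi i nx}$, put $f(V)=\sum_n f_nV^n\in\mathcal{A}_\theta$. A projection is a selfadjoint idempotent. A projection $p\in\mathcal{A}_\theta$ is of order $M$ if it has the form $p=\sum_{n=-M}^{M}U^np_n(V)$ with all $p_n\in C^\infty(\mathbb{R}/\mathbb{Z})$ (complex-valued) and $p_M\neq 0$ (not identically zero). The canonical trace $\tau$ on $\mathcal{A}_\theta$ is $\tau\big(\sum a_{m,n}U^mV^n\big)=a_{0,0}$; on elements $b=\sum_{m\text{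 finite}}U^mb_m(V)$ it equals $\int_0^1b_0(x)\,dx$. The $K_0$ class of a projection in $\mathcal{A}_\theta$ is uniquely determined by its trace (a known fact), and for a real number $t$ the symbol $[t]\in K_0(\mathcal{A}_\theta)$ denotes the $K_0$ class represented by a projection $p\in\mathcal{A}_\theta$ with $\tau(p)=t$. *)

(* Defs.v *)
From HB Require Import structures.
From mathcomp Require Import all_boot all_order all_algebra.
From mathcomp Require Export complex.
From mathcomp Require Import all_classical all_reals all_analysis.
Set Implicit Arguments.
Unset Strict Implicit.
Unset Printing Implicit Defensive.
Import Order.TTheory GRing.Theory Num.Theory.
Import numFieldNormedType.Exports.
Local Open Scope classical_set_scope.
Local Open Scope ring_scope.

(* Unital C*-algebras over the complex numbers R[i].  Mathcomp's algType is
   unital with 1 != 0.  The norm is a field of its own rather than a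
   normedModType structure because the hierarchy offers no common refinement of
   normed modules and noncommutative rings: a type carrying both a ring
   structure and a norm `|_| is forced to be a numDomainType. *)
HB.mixin Record isCStarAlgebra (R : realType) A of GRing.Algebra R[i] A := {
  star : A -> A;
  star_semilinear : forall (a : R[i]) (x y : A),
    star (a *: x + y) = a^* *: star x + star y;
  starK : involutive star;
  starM : forall x y : A, star (x * y) = star y * star x;
  cnorm : A -> R;
  cnorm0_eq0 : forall x : A, cnorm x = 0 -> x = 0;
  cnormD_le : forall x y : A, cnorm (x + y) <= cnorm x + cnorm y;
  cnormZ : forall (a : R[i]) (x : A),
    ((cnorm (a *: x))%:C)%C = `|a| * ((cnorm x)%:C)%C;
  cnormM_le : forall x y : A, cnorm (x * y) <= cnorm x * cnorm y;
  cstar_identity : forall x : A, cnorm (star x * x) = cnorm x ^+ 2;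
  cnorm_complete : forall u : nat -> A,
    (forall e : R, 0 < e -> exists N : nat, forall m n : nat,
       (N <= m)%N -> (N <= n)%N -> cnorm (u m - u n) < e) ->
    exists x : A, cnorm (u n - x) @[n --> \oo] --> (0 : R)
}.

#[short(type="cstarAlgType")]
HB.structure Definition CStarAlgebra (R : realType) :=
  { A of isCStarAlgebra R A & GRing.Algebra R[i] A }.

Section NCTorus.
Context {R : realType}.

Definition expi (x : R) : R[i] :=
  (cos (2 * pi * x) +i* sin (2 * pi * x))%C.

Definition norm_cvg (A : cstarAlgType R) (u : nat -> A) (x : A) : Prop :=
  cnorm (u n - x) @[n --> \oo] --> (0 : R).

Definition unitary (A : cstarAlgType R) (u : A) : Prop :=
  star u * u = 1 /\ u * star u = 1.

Definition rotation_relations (theta : R) (A : cstarAlgType R) (U V : A)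
    : Prop :=
  [/\ unitary U, unitary V & V * U = expi theta *: (U * V)].

Definition star_hom (A B : cstarAlgType R) (phi : {lrmorphism A -> B})
    : Prop :=
  forall x, phi (star x) = star (phi x).

(* (A, U, V) is the universal C*-algebra generated by two unitaries subject to
   V U = e^(2 i pi theta) U V.  Uniqueness of phi expresses that U and V
   generate A. *)
Definition is_nctorus (theta : R) (A : cstarAlgType R) (U V : A) : Prop :=
  rotation_relations theta U V /\
  forall (B : cstarAlgType R) (u v : B), rotation_relations theta u v ->
    (exists phi : {lrmorphism A -> B}, [/\ star_hom phi, phi U = u & phi V = v])
    /\ (forall phi psi : {lrmorphism A -> B},
          star_hom phi -> star_hom psi ->
          phi U = psi U -> phi V = psi V -> phi =1 psi).

(* Integer power of a unitary, whose inverse is its adjoint. *)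
Definition upow (A : cstarAlgType R) (u : A) (m : int) : A :=
  match m with Posz k => u ^+ k | Negz k => star u ^+ k.+1 end.

Definition zrange (N : nat) : seq int :=
  [seq k%:Z - N%:Z | k <- iota 0 N.*2.+1].

Definition schwartz (a : int -> int -> R[i]) : Prop :=
  forall k : nat, exists C : R, forall m n : int,
    (1 + absz m + absz n)%N%:R ^+ k * `|a m n| <= (C%:C)%C.

(* x = \sum_(m, n) a_(m, n) U^m V^n, a norm-convergent sum.  The series is
   absolutely convergent when a is rapidly decreasing, so that the choice of
   square partial sums is immaterial. *)
Definition torus_sum (A : cstarAlgType R) (U V : A)
    (a : int -> int -> R[i]) (x : A) : Prop :=
  norm_cvg (fun N : nat => \sum_(m <- zrange N) \sum_(n <- zrange N)
     a m n *: (upow U m * upow V n)) x.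

Definition smooth_torus (A : cstarAlgType R) (U V : A) : set A :=
  [set x | exists2 a, schwartz a & torus_sum U V a x].

(* The coefficients of an element of the smooth torus.  Their uniqueness makes
   them a function of x; the default 0 is taken only off the smooth torus. *)
Definition torus_coef (A : cstarAlgType R) (U V : A) (x : A)
    : int -> int -> R[i] :=
  xget (fun _ _ => 0) [set a | schwartz a /\ torus_sum U V a x].

Definition torus_trace (A : cstarAlgType R) (U V : A) (x : A) : R[i] :=
  torus_coef U V x 0 0.

Definition projection (A : cstarAlgType R) (p : A) : Prop :=
  star p = p /\ p * p = p.

Definition smooth_periodic (f : R -> R[i]) : Prop :=
  (forall x, f (x + 1) = f x) /\
  forall (k : nat) (x : R),
    derivable (derive1n k (fun y => complex.Re (f y))) x 1 /\
    derivable (derive1n k (fun y => complex.Im (f y))) x 1.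

Definition fourier_coef (f : R -> R[i]) (n : int) : R[i] :=
  let g x := f x * expi (- n%:~R * x) in
  (Rintegral lebesgue_measure `[0%R, 1%R] (fun x => complex.Re (g x))
   +i* Rintegral lebesgue_measure `[0%R, 1%R] (fun x => complex.Im (g x)))%C.

(* f(V) = \sum_n f_n V^n; the series is absolutely convergent for smooth f. *)
Definition fun_of_unitary (A : cstarAlgType R) (V : A) (f : R -> R[i]) : A :=
  xget 0 [set x | norm_cvg
    (fun N : nat => \sum_(n <- zrange N) fourier_coef f n *: upow V n) x].

Definition projection_of_order (A : cstarAlgType R) (U V : A) (M : nat)
    (p : A) : Prop :=
  [/\ projection p, smooth_torus U V p &
      exists p_ : int -> R -> R[i],
        [/\ forall n : int, - M%:Z <= n <= M%:Z -> smooth_periodic (p_ n),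
            p = \sum_(n <- zrange M) upow U n * fun_of_unitary V (p_ n)
          & exists x, p_ M%:Z x != 0]].

(* Equality of the classes of two idempotents p, q in K_0 of the smooth torus
   algebra S: for some k, the idempotents diag(p, 1_k) and diag(q, 1_k) of
   M_(1+k)(S) are algebraically equivalent over S, i.e. the corresponding
   finitely generated projective S-modules are stably isomorphic. *)
Definition same_K0_class (A : cstarAlgType R) (U V : A) (p q : A) : Prop :=
  exists k : nat, exists x y : 'M[A]_(1 + k),
    [/\ forall i j, smooth_torus U V (x i j),
        forall i j, smooth_torus U V (y i j),
        x *m y = block_mx p%:M 0 0 1%:M
      & y *m x = block_mx q%:M 0 0 1%:M].

(* [t] is the K_0 class of a projection of trace t; projections of equal trace
   have the same class, so the choice of q does not matter. *)
Definition represents_K0 (A : cstarAlgType R) (U V : A) (t : R) (p : A)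
    : Prop :=
  exists q : A, [/\ projection q, smooth_torus U V q,
    torus_trace U V q = (t%:C)%C & same_K0_class U V p q].

End NCTorus.

(* Main.v *)
(* Represent A on L^2(R/Z) by V = multiplication by e^(2 i pi x) and U = rotation
   by theta. A Rieffel projection f(V) + U^k g(V) + g(V) U^-k has trace
   int f = k theta, and it can be supported in any interval of length larger than
   k theta; it acts as the identity on the plateau of f, an interval of length
   almost k theta. If M <= n, add to one of order M a disjointly supported sum of
   n - M of order 1; if n < M, subtract from it such a sum of M - n of order 1
   supported in its plateau. The class [1 - n theta] is then that of 1 - p.

   The functional calculus f |-> f(V) is built from Fourier series only: Fejer
   means give pointwise inversion, hence uniform convergence of the partial sums
   of f, f' and f'', while ||f(V)|| is bounded by the sup norms of f and f''.
   The coefficient of U^0 V^0 is determined by averaging over conjugation by powers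
   of V and of U, which kills all other coefficients since theta is irrational. *)

Require Import Defs.
From mathcomp Require Import all_boot all_order all_algebra.
From mathcomp Require Import complex.
From mathcomp Require Import all_classical all_reals all_analysis.
From mathcomp Require Import zify ring lra.
Import Order.TTheory GRing.Theory Num.Theory.
Import numFieldNormedType.Exports.
Local Open Scope ring_scope.
Set Implicit Arguments.
Unset Strict Implicit.
Unset Printing Implicit Defensive.

(** * Smooth functions and integration over a period *)

(** The delicate point is that f |-> f(V) is multiplicative. When the left factor is a trigonometric
    polynomial the product formula is exact, because multiplying a function by e^(2 i pi x) shifts
    its coefficients, which amounts to multiplying by V. For general f the error is the image of
    (f_N - f) g with f_N a partial sum. The norm bound for that image involves a second derivative,
    which is why f, f' and f'' must all be approximated uniformly, here at rate 1/(N+1). Symbols are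
    real-valued, so a complex function u + i v only occurs as a pair of real functions combined with
    [ii]. Limits of averages are replaced by inequalities N a <= N b + c valid for all N, which
    force a <= b; this serves the Fejer means, translation invariance and the averaging over
    conjugations alike. The bound theta < 1/max(n, M) is room on a circle of length 1: M theta < 1
    lets the order M block fit, and n theta < 1 leaves space for the n - M further blocks when M <=
    n. In K_0, each projection built serves as its own reference projection of the required
    trace. *)

Section Smooth.
Context {R : realType}.
Implicit Types (f g : R -> R) (k : nat) (a b c s x B : R).

Definition deriv f f' := forall x : R, is_derive x 1 f (f' x).

Lemma deriv_ext f g' f' : deriv f f' -> f' =1 g' -> deriv f g'.
Proof. by move=> df e x; rewrite -e. Qed.

Lemma deriv_cst (c : R) : deriv (fun=> c) (fun=> 0).
Proof. by move=> x; exact: is_derive_cst. Qed.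

Lemma deriv_lin (a b : R) : deriv (fun x => a * x + b) (fun=> a).
Proof.
move=> x; have -> : (fun x => a * x + b) = (a *: id + cst b) :> (R -> R) by [].
by apply: is_derive_eq; rewrite addr0 [_ *: _]mulr1.
Qed.

Lemma derivD f g f' g' : deriv f f' -> deriv g g' ->
  deriv (fun x => f x + g x) (fun x => f' x + g' x).
Proof. by move=> df dg x; exact: (is_deriveD (df x) (dg x)). Qed.

Lemma derivM f g f' g' : deriv f f' -> deriv g g' ->
  deriv (fun x => f x * g x) (fun x => f x * g' x + g x * f' x).
Proof. by move=> df dg x; exact: (is_deriveM (df x) (dg x)). Qed.

Lemma deriv_comp f g f' g' : deriv f f' -> deriv g g' ->
  deriv (fun x => f (g x)) (fun x => f' (g x) * g' x).
Proof. by move=> df dg x; exact: (is_derive1_comp (df (g x)) (dg x)). Qed.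

Lemma derivV f f' : deriv f f' -> (forall x, f x != 0) ->
  deriv (fun x => (f x)^-1) (fun x => - ((f x)^-1 * (f x)^-1) * f' x).
Proof.
move=> df f0 x; apply: is_derive_eq (is_deriveV (f0 x) (df x)) _.
by rewrite expr2 invfM.
Qed.

Lemma deriv_uniq f f' g' : deriv f f' -> deriv f g' -> f' =1 g'.
Proof.
move=> df dg x.
by rewrite -(@derive_val _ _ _ _ _ _ _ (df x)) (@derive_val _ _ _ _ _ _ _ (dg x)).
Qed.

Lemma deriv_continuous f f' : deriv f f' -> continuous f.
Proof.
by move=> df x; apply: differentiable_continuous; apply/derivable1_diffP; case: (df x).
Qed.

(** Derivatives are existential witnesses, so closure under sums, products, inverses and composition
    is an induction on k; [smooth_derivable] converts to the iterated [derive1n] of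
    [smooth_periodic]. *)
Fixpoint Ck k f : Prop :=
  if k is k'.+1 then exists f', deriv f f' /\ Ck k' f' else True.

Definition smooth f := forall k, Ck k f.

Lemma CkW k f : Ck k.+1 f -> Ck k f.
Proof. by elim: k f => // k IH f [f' [df cf]]; exists f'; split=> //; exact: IH. Qed.

Lemma Ck_cst k c : Ck k (fun=> c).
Proof. by elim: k c => // k IH c; exists (fun=> 0); split => //; exact: deriv_cst. Qed.

Lemma CkD k f g : Ck k f -> Ck k g -> Ck k (fun x => f x + g x).
Proof.
elim: k f g => // k IH f g [f' [df cf]] [g' [dg cg]].
by exists (fun x => f' x + g' x); split; [exact: derivD|exact: IH].
Qed.

Lemma CkM k f g : Ck k f -> Ck k g -> Ck k (fun x => f x * g x).
Proof.
elim: k f g => // k IH f g /[dup] /CkW cf0 [f' [df cf]] /[dup] /CkW cg0 [g' [dg cg]].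
(* The derivative contains f and g themselves, which are brought down to level k by [CkW]. *)
exists (fun x => f x * g' x + g x * f' x); split; first exact: derivM.
by apply: CkD; exact: IH.
Qed.

Lemma CkN k f : Ck k f -> Ck k (fun x => - f x).
Proof.
move=> cf; have -> : (fun x => - f x) = (fun x => -1 * f x).
  by apply/funext => x; rewrite mulN1r.
by apply: CkM => //; exact: Ck_cst.
Qed.

Lemma CkV k f : (forall x, f x != 0) -> Ck k f -> Ck k (fun x => (f x)^-1).
Proof.
move=> f0; elim: k => // k IH /[dup] /CkW cf0 [f' [df cf]].
exists (fun x => - ((f x)^-1 * (f x)^-1) * f' x); split; first exact: derivV.
by apply: CkM => //; apply: CkN; apply: CkM; exact: IH.
Qed.

Lemma Ck_lin k a b : Ck k (fun x => a * x + b).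
Proof. by case: k => // k; exists (fun=> a); split; [exact: deriv_lin|exact: Ck_cst]. Qed.

Lemma Ck_comp k f g : Ck k f -> Ck k g -> Ck k (fun x => f (g x)).
Proof.
elim: k f g => // k IH f g [f' [df cf]] /[dup] /CkW cg0 [g' [dg cg]].
exists (fun x => f' (g x) * g' x); split; first exact: deriv_comp.
by apply: CkM => //; exact: IH.
Qed.

Lemma Ck_sin_cos k : Ck k (@sin R) /\ Ck k (@cos R).
Proof.
elim: k => // k [IHs IHc]; split.
  by exists (@cos R); split=> // x; exact: is_derive_sin.
by exists (fun x => - sin x); split; [move=> x; exact: is_derive_cos|exact: CkN].
Qed.

Lemma smooth_cst c : smooth (fun=> c). Proof. by move=> k; exact: Ck_cst. Qed.
Lemma smoothD f g : smooth f -> smooth g -> smooth (fun x => f x + g x).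
Proof. by move=> sf sg k; exact: CkD. Qed.
Lemma smoothM f g : smooth f -> smooth g -> smooth (fun x => f x * g x).
Proof. by move=> sf sg k; exact: CkM. Qed.
Lemma smoothN f : smooth f -> smooth (fun x => - f x).
Proof. by move=> sf k; exact: CkN. Qed.
Lemma smoothB f g : smooth f -> smooth g -> smooth (fun x => f x - g x).
Proof. by move=> sf sg; exact/smoothD/smoothN. Qed.
Lemma smoothV f : (forall x, f x != 0) -> smooth f -> smooth (fun x => (f x)^-1).
Proof. by move=> f0 sf k; exact: CkV. Qed.
Lemma smooth_comp f g : smooth f -> smooth g -> smooth (fun x => f (g x)).
Proof. by move=> sf sg k; exact: Ck_comp. Qed.
Lemma smooth_lin a b : smooth (fun x => a * x + b).
Proof. by move=> k; exact: Ck_lin. Qed.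
Lemma smooth_shift f s : smooth f -> smooth (fun x => f (x + s)).
Proof.
move=> sf; have := smooth_comp sf (smooth_lin 1 s).
by under [in X in X -> _]eq_fun do rewrite mul1r.
Qed.

(** Each [Ck k] brings its own derivative; uniqueness identifies all of them with the one coming
    from [Ck 1]. *)
Lemma smooth_deriv f : smooth f -> exists2 f', deriv f f' & smooth f'.
Proof.
move=> sf; have [f' [df _]] := sf 1; exists f' => // k.
have [g' [dg cg]] := sf k.+1.
by rewrite (_ : f' = g') //; apply/funext; exact: deriv_uniq dg.
Qed.

Lemma smooth_continuous f : smooth f -> continuous f.
Proof. by move=> /smooth_deriv[f' /deriv_continuous]. Qed.

Lemma deriv_derive1 f f' : deriv f f' -> (f^`())%classic = f'.
Proof.
by move=> df; apply/funext => x; rewrite derive1E; exact: (@derive_val _ _ _ _ _ _ _ (df x)).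
Qed.

Lemma smooth_derivable f k (x : R) : smooth f -> derivable (derive1n k f) x 1.
Proof.
elim: k f => [|k IH] f /smooth_deriv[f' df sf'].
  by rewrite derive1n0; case: (df x).
by rewrite derive1Sn (deriv_derive1 df); exact: IH.
Qed.

Definition smper f := smooth f /\ forall x, f (x + 1) = f x.

Lemma smper_cst c : smper (fun=> c). Proof. by split=> //; exact: smooth_cst. Qed.
Lemma smperD f g : smper f -> smper g -> smper (fun x => f x + g x).
Proof. by move=> [sf pf] [sg pg]; split=> [|x]; [exact: smoothD|rewrite pf pg]. Qed.
Lemma smperM f g : smper f -> smper g -> smper (fun x => f x * g x).
Proof. by move=> [sf pf] [sg pg]; split=> [|x]; [exact: smoothM|rewrite pf pg]. Qed.
Lemma smperN f : smper f -> smper (fun x => - f x).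
Proof. by move=> [sf pf]; split=> [|x]; [exact: smoothN|rewrite pf]. Qed.
Lemma smperB f g : smper f -> smper g -> smper (fun x => f x - g x).
Proof. by move=> sf sg; exact/smperD/smperN. Qed.
Lemma smper_shift f s : smper f -> smper (fun x => f (x + s)).
Proof. by move=> [sf pf]; split=> [|x]; [exact: smooth_shift|rewrite addrAC pf]. Qed.

Lemma deriv_shift f f' s : deriv f f' -> deriv (fun x => f (x + s)) (fun x => f' (x + s)).
Proof.
move=> df; have := deriv_comp df (deriv_lin 1 s).
under [in X in deriv X _ -> _]eq_fun do rewrite mul1r.
by move/deriv_ext; apply=> x; rewrite mul1r mulr1.
Qed.

Lemma smper_deriv f : smper f -> exists2 f', deriv f f' & smper f'.
Proof.
move=> [/smooth_deriv[f' df sf'] pf]; exists f' => //; split=> // x.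
have df1 := deriv_shift 1 df.
rewrite (_ : (fun x => f (x + 1)) = f) in df1; last by apply/funext.
exact: (deriv_uniq df1 df).
Qed.

Lemma per_int f (z : int) x : (forall x, f (x + 1) = f x) -> f (x + z%:~R) = f x.
Proof.
move=> pf; elim/int_rect: z x => [|n IH|n IH] x; first by rewrite addr0.
  by rewrite -addn1 PoszD intrD addrA pf IH.
by rewrite -pf -addn1 PoszD opprD intrD addrA subrK IH.
Qed.

Lemma per_frac f x : (forall x, f (x + 1) = f x) -> f (x - (Num.floor x)%:~R) = f x.
Proof. by move=> pf; rewrite -mulrNz per_int. Qed.

Lemma frac_itv (x : R) : 0 <= x - (Num.floor x)%:~R < 1.
Proof. by have := floor_itv x; rewrite intrD => /andP[? ?]; apply/andP; split; lra. Qed.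

Lemma smper_bounded f : smper f -> exists2 B : R, 0 < B & forall x, `|f x| <= B.
Proof.
move=> [sf pf].
have cf : {within `[0, 1], continuous (fun x => `|f x|)}%classic.
  apply: continuous_subspaceT => x.
  by apply: (@continuous_comp _ _ _ f); [exact: smooth_continuous|exact: norm_continuous].
have [c _ hc] := EVT_max ler01 cf.
exists (`|f c| + 1) => [|x]; first by rewrite ltr_wpDl.
have /andP[x0 x1] := frac_itv x.
rewrite -(per_frac x pf); apply: (le_trans (hc _ _)); last by rewrite lerDl.
by rewrite in_itv/= x0 ltW.
Qed.

End Smooth.

(** * Integrals over [0, 1] *)

Section Integral.
Context {R : realType}.
Implicit Types (f g : R -> R) (c B : R).

Definition I01 f : R := Rintegral lebesgue_measure `[0%R, 1%R]%classic f.

Lemma continuous_integrable f (a b : R) : continuous f ->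
  (@lebesgue_measure R).-integrable `[a, b]%classic (EFin \o f).
Proof.
move=> cf; apply: continuous_compact_integrable; first exact: segment_compact.
exact: continuous_subspaceT.
Qed.

Let mI : measurable (`[0%R, 1%R]%classic : set (measurableTypeR R)).
Proof. exact: measurable_itv. Qed.

Lemma I01D f g : continuous f -> continuous g -> I01 (fun x => f x + g x) = I01 f + I01 g.
Proof. by move=> cf cg; rewrite /I01 RintegralD//; exact: continuous_integrable. Qed.

Lemma I01Z c f : continuous f -> I01 (fun x => c * f x) = c * I01 f.
Proof. by move=> cf; rewrite /I01 RintegralZl//; exact: continuous_integrable. Qed.

Lemma I01_FTC F f : deriv F f -> continuous f -> I01 f = F 1 - F 0.
Proof.
move=> dF cf; rewrite /I01 /Rintegral.
have cF := deriv_continuous dF.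
rewrite (@continuous_FTC2 _ f F 0 1) ?ltr01//.
- exact: continuous_subspaceT.
- split=> [x _||]; first by case: (dF x).
    exact: (cvg_at_right_filter (cF _)).
  exact: (cvg_at_left_filter (cF _)).
- by move=> x _; rewrite (deriv_derive1 dF).
Qed.

Lemma I01_cst c : I01 (fun=> c) = c.
Proof.
rewrite (I01_FTC (deriv_lin c 0)); first by ring.
by move=> x; exact: cvg_cst.
Qed.

Lemma I01_le f g : continuous f -> continuous g -> (forall x, f x <= g x) -> I01 f <= I01 g.
Proof.
by move=> cf cg fg; apply: le_Rintegral => //; exact: continuous_integrable.
Qed.

Lemma I01_norm f B : continuous f -> (forall x, `|f x| <= B) -> `|I01 f| <= B.
Proof.
move=> cf fB; have cc (c : R) : continuous (fun _ : R => c) by move=> x; exact: cvg_cst.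
rewrite ler_norml -{1}(I01_cst (- B)) -{2}(I01_cst B); apply/andP; split.
all: by apply: I01_le => // x; have := fB x; rewrite ler_norml => /andP[? ?].
Qed.

Lemma I01_sum (T : Type) (r : seq T) (F : T -> R -> R) : (forall i, continuous (F i)) ->
  I01 (fun x => \sum_(i <- r) F i x) = \sum_(i <- r) I01 (F i).
Proof.
move=> cF; have cc (c : R) : continuous (fun _ : R => c) by move=> x; exact: cvg_cst.
have cS s : continuous (fun x => \sum_(i <- s) F i x).
  elim: s => [|i s IH]; first by under eq_fun do rewrite big_nil; exact: cc.
  under eq_fun do rewrite big_cons; move=> x.
  exact: (@cvgD _ _ _ (nbhs x) _ (F i) (fun x => \sum_(i <- s) F i x) _ _ (cF i x) (IH x)).
elim: r => [|i r IH]; first by rewrite big_nil; under eq_fun do rewrite big_nil; exact: I01_cst.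
by rewrite big_cons; under eq_fun do rewrite big_cons; rewrite I01D// IH.
Qed.

(** The boundary terms cancel by periodicity; integration by parts for Fourier coefficients rests on
    this. *)
Lemma I01_deriv_per f f' : deriv f f' -> continuous f' -> (forall x, f (x + 1) = f x) ->
  I01 f' = 0.
Proof. by move=> df cf' pf; rewrite (I01_FTC df cf') -{1}[1]add0r pf subrr. Qed.

End Integral.

(** * Fourier coefficients *)

Section Zrange.

Lemma zrangeS N : zrange N.+1 = (- N.+1%:Z) :: rcons (zrange N) N.+1%:Z.
Proof.
have -> : zrange N.+1 = [seq k%:Z - N.+1%:Z | k <- iota 0 (1 + (N.*2.+1 + 1))].
  by rewrite /zrange doubleS addn1 add1n.
rewrite iotaD map_cat iotaD map_cat -cats1 -cat1s; congr (_ ++ (_ ++ _)).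
  by rewrite /= sub0r.
  rewrite /zrange [(0 + 1)%N]addnC iotaDl -map_comp; apply: eq_map => k /=.
  by rewrite -(addn1 N) !PoszD; ring.
by rewrite /= -(addn1 N) -addnn; congr [:: _]; lia.
Qed.

Lemma zrange0 : zrange 0 = [:: 0].
Proof. by []. Qed.

Lemma zsumS (V : nmodType) (F : int -> V) N :
  \sum_(n <- zrange N.+1) F n = \sum_(n <- zrange N) F n + (F N.+1 + F (- N.+1%:Z)).
Proof. by rewrite zrangeS big_cons -cats1 big_cat big_seq1 /= addrC -addrA. Qed.

Lemma zsum0 (V : nmodType) (F : int -> V) : \sum_(n <- zrange 0) F n = F 0.
Proof. by rewrite zrange0 big_seq1. Qed.

Lemma mem_zrange N (n : int) : (n \in zrange N) = (- N%:Z <= n <= N%:Z).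
Proof.
apply/mapP/andP => [[k]|[n1 n2]].
  rewrite mem_iota -addnn => /andP[_ kN] ->; split; lia.
by exists (absz (n + N%:Z)); [rewrite mem_iota -addnn; lia|lia].
Qed.

Lemma zrange_uniq N : uniq (zrange N).
Proof. by rewrite map_inj_uniq ?iota_uniq// => i j ij; lia. Qed.

End Zrange.

(** * Sequences with increments of order 1/N^2 *)

Section Telescope.
Context {R : realType} (V : zmodType) (nrm : V -> R).
Hypothesis nrm0 : nrm 0 = 0.
Hypothesis nrmD : forall x y, nrm (x + y) <= nrm x + nrm y.

(** Since B/(m+1)^2 <= 2B/(m+1) - 2B/(m+2), with equality at m = 0, the increments are dominated by
    a telescoping sum. The norm is abstract because both real numbers and the C*-norm are meant. *)
Lemma inv_sqr_telescope (u : nat -> V) (B : R) : 0 <= B ->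
  (forall N, nrm (u N.+1 - u N) <= B / N.+1%:R ^+ 2) ->
  forall m N, (N <= m)%N -> nrm (u m - u N) <= 2 * B / N.+1%:R.
Proof.
move=> B0 hu m N Nm.
suff h : nrm (u m - u N) <= 2 * B / N.+1%:R - 2 * B / m.+1%:R.
  by apply: (le_trans h); rewrite lerBlDr lerDl divr_ge0// mulr_ge0.
elim: m Nm => [|m IH]; first by rewrite leqn0 => /eqP ->; rewrite !subrr nrm0.
rewrite leq_eqVlt => /predU1P[->|]; first by rewrite !subrr nrm0.
rewrite ltnS => /IH {}IH; rewrite -(subrK (u m) (u m.+1)) -addrA.
apply: (le_trans (nrmD _ _)); apply: (le_trans (lerD (hu m) IH)).
rewrite addrCA lerD2l -lerBrDr opprK.
have m0 : (0 : R) <= m%:R by [].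
have -> : m.+2%:R = m%:R + 2 :> R by rewrite -addn2 natrD.
have -> : m.+1%:R = m%:R + 1 :> R by rewrite -addn1 natrD.
set x := m%:R in m0 *.
rewrite -subr_ge0 (_ : _ - _ = B * x / ((x + 1) ^+ 2 * (x + 2))); last first.
  by field; apply/andP; split; apply: lt0r_neq0; lra.
by rewrite divr_ge0// mulr_ge0// ?exprn_ge0//; lra.
Qed.

End Telescope.

Section Fourier.
Context {R : realType}.
Implicit Types (f g : R -> R) (m n : int) (N : nat) (c x y B : R).

(** [cz] and [sz] are the real and imaginary parts of e^(2 i pi n x), kept apart because derivatives
    and integrals are taken of real functions only. *)
Definition cz n (x : R) : R := cos (2 * pi * (n%:~R * x)).
Definition sz n (x : R) : R := sin (2 * pi * (n%:~R * x)).
Definition ca f n := I01 (fun x => f x * cz n x).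
Definition cb f n := I01 (fun x => f x * sz n x).

Lemma cz0 x : cz 0 x = 1. Proof. by rewrite /cz mul0r mulr0 cos0. Qed.
Lemma sz0 x : sz 0 x = 0. Proof. by rewrite /sz mul0r mulr0 sin0. Qed.
Lemma czN n x : cz (- n) x = cz n x.
Proof. by rewrite /cz mulrNz mulNr mulrN cosN. Qed.
Lemma szN n x : sz (- n) x = - sz n x.
Proof. by rewrite /sz mulrNz mulNr mulrN sinN. Qed.
Lemma czD m n x : cz (m + n) x = cz m x * cz n x - sz m x * sz n x.
Proof. by rewrite /cz /sz; set c := 2 * pi; rewrite intrD mulrDl mulrDr cosD. Qed.
Lemma szD m n x : sz (m + n) x = sz m x * cz n x + cz m x * sz n x.
Proof. by rewrite /cz /sz; set c := 2 * pi; rewrite intrD mulrDl mulrDr sinD. Qed.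
Lemma czB_arg n x y : cz n (x - y) = cz n x * cz n y + sz n x * sz n y.
Proof. by rewrite /cz /sz; set c := 2 * pi; rewrite !mulrBr cosB. Qed.
Lemma czD_arg n x y : cz n (x + y) = cz n x * cz n y - sz n x * sz n y.
Proof. by rewrite /cz /sz; set c := 2 * pi; rewrite !mulrDr cosD. Qed.
Lemma szD_arg n x y : sz n (x + y) = sz n x * cz n y + cz n x * sz n y.
Proof. by rewrite /cz /sz; set c := 2 * pi; rewrite !mulrDr sinD. Qed.
Lemma cz2Dsz2 n x : cz n x ^+ 2 + sz n x ^+ 2 = 1.
Proof. exact: cos2Dsin2. Qed.
Lemma cz_le1 n x : cz n x <= 1. Proof. exact: cos_le1. Qed.
Lemma normr_cz n x : `|cz n x| <= 1. Proof. exact: cos_max. Qed.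
Lemma normr_sz n x : `|sz n x| <= 1. Proof. exact: sin_max. Qed.

Lemma deriv_cz n : deriv (cz n) (fun x => - (2 * pi * n%:~R * sz n x)).
Proof.
have -> : cz n = (fun x => cos (2 * pi * n%:~R * x + 0)).
  by apply/funext => x; rewrite addr0 /cz mulrA.
apply: deriv_ext (deriv_comp (fun x => is_derive_cos x) (deriv_lin _ _)) _ => x.
by rewrite addr0 /sz [2 * pi * (_ * _)]mulrA; ring.
Qed.

Lemma deriv_sz n : deriv (sz n) (fun x => 2 * pi * n%:~R * cz n x).
Proof.
have -> : sz n = (fun x => sin (2 * pi * n%:~R * x + 0)).
  by apply/funext => x; rewrite addr0 /sz mulrA.
apply: deriv_ext (deriv_comp (fun x => is_derive_sin x) (deriv_lin _ _)) _ => x.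
by rewrite addr0 /cz [2 * pi * (_ * _)]mulrA; ring.
Qed.

Lemma per_cz_sz n x : cz n (x + 1) = cz n x /\ sz n (x + 1) = sz n x.
Proof.
suff [c1 s1] : cz n 1 = 1 /\ sz n 1 = 0.
  by rewrite czD_arg szD_arg c1 s1 !mulr0 !mulr1 subr0 addr0.
rewrite /cz /sz mulr1; elim/int_rect: n => [|n [IHc IHs]|n [IHc IHs]].
- by rewrite mulr0 cos0 sin0.
- rewrite (_ : 2 * pi * n.+1%:~R = 2 * pi * n%:~R + pi *+ 2); first by rewrite cosD2pi sinD2pi.
  by rewrite -(addn1 n) PoszD intrD -[pi *+ 2]mulr_natl; set c := 2 * pi; rewrite mulrDr mulr1.
- have e : 2 * pi * (- n.+1%:Z)%:~R + pi *+ 2 = 2 * pi * (- n%:Z)%:~R :> R.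
    rewrite -[pi *+ 2]mulr_natl; set c := 2 * pi.
    by rewrite -{2}[c]mulr1 -mulrDr -(addn1 n) PoszD opprD intrD mulrN1z subrK.
  by rewrite -[cos _]cosD2pi -[sin _]sinD2pi e.
Qed.

Lemma smper_cz n : smper (cz n).
Proof.
split=> [|x]; last by have [] := per_cz_sz n x.
have -> : cz n = (fun x => cos (2 * pi * n%:~R * x + 0)).
  by apply/funext => x; rewrite addr0 /cz mulrA.
by apply: smooth_comp (smooth_lin _ _) => k; have [] := @Ck_sin_cos R k.
Qed.

Lemma smper_sz n : smper (sz n).
Proof.
split=> [|x]; last by have [] := per_cz_sz n x.
have -> : sz n = (fun x => sin (2 * pi * n%:~R * x + 0)).
  by apply/funext => x; rewrite addr0 /sz mulrA.
by apply: smooth_comp (smooth_lin _ _) => k; have [] := @Ck_sin_cos R k.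
Qed.

Lemma smper_continuous f : smper f -> continuous f.
Proof. by move=> [/smooth_continuous]. Qed.

Let smc f n : smper f -> continuous (fun x => f x * cz n x).
Proof. by move=> sf; apply/smper_continuous/smperM => //; exact: smper_cz. Qed.
Let sms f n : smper f -> continuous (fun x => f x * sz n x).
Proof. by move=> sf; apply/smper_continuous/smperM => //; exact: smper_sz. Qed.

Lemma caN f n : ca f (- n) = ca f n.
Proof. by rewrite /ca; under eq_fun do rewrite czN. Qed.

Lemma cbN f n : smper f -> cb f (- n) = - cb f n.
Proof.
move=> sf; rewrite /cb -[RHS]mulN1r -I01Z; last exact: sms.
by congr I01; apply/funext => x; rewrite szN mulrN mulN1r.
Qed.

Lemma caD f g n : smper f -> smper g -> ca (fun x => f x + g x) n = ca f n + ca g n.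
Proof.
move=> sf sg; rewrite /ca -I01D; [|exact: smc|exact: smc].
by congr I01; apply/funext => x; rewrite mulrDl.
Qed.

Lemma cbD f g n : smper f -> smper g -> cb (fun x => f x + g x) n = cb f n + cb g n.
Proof.
move=> sf sg; rewrite /cb -I01D; [|exact: sms|exact: sms].
by congr I01; apply/funext => x; rewrite mulrDl.
Qed.

Lemma caZ c f n : smper f -> ca (fun x => c * f x) n = c * ca f n.
Proof.
move=> sf; rewrite /ca -I01Z; last exact: smc.
by congr I01; apply/funext => x; rewrite mulrA.
Qed.

Lemma cbZ c f n : smper f -> cb (fun x => c * f x) n = c * cb f n.
Proof.
move=> sf; rewrite /cb -I01Z; last exact: sms.
by congr I01; apply/funext => x; rewrite mulrA.
Qed.

Lemma ca_le f n B : smper f -> (forall x, `|f x| <= B) -> `|ca f n| <= B.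
Proof.
move=> sf fB; apply: I01_norm => [|x]; first exact: smc.
rewrite normrM -[B]mulr1; apply: ler_pM => //; exact: normr_cz.
Qed.

Lemma cb_le f n B : smper f -> (forall x, `|f x| <= B) -> `|cb f n| <= B.
Proof.
move=> sf fB; apply: I01_norm => [|x]; first exact: sms.
rewrite normrM -[B]mulr1; apply: ler_pM => //; exact: normr_sz.
Qed.

(** Integration by parts: the derivative of f times [cz n] has zero integral over a period. *)
Lemma ca_deriv f f' n : smper f -> smper f' -> deriv f f' ->
  ca f' n = 2 * pi * n%:~R * cb f n.
Proof.
move=> sf sf' df; have d := derivM df (deriv_cz n).
have s1 : smper (fun x => - (2 * pi * n%:~R) * (f x * sz n x)).
  by apply: smperM (smper_cst _) (smperM sf (smper_sz n)).
have s2 : smper (fun x => f' x * cz n x) by apply: smperM => //; exact: smper_cz.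
have d' : deriv (fun x => f x * cz n x)
    (fun x => - (2 * pi * n%:~R) * (f x * sz n x) + f' x * cz n x).
  by apply: deriv_ext d _ => x; ring.
have /eqP := I01_deriv_per d' (smper_continuous (smperD s1 s2))
  (smperM sf (smper_cz n)).2.
rewrite I01D ?I01Z; [|exact: sms|exact: smper_continuous|exact: smper_continuous].
by rewrite mulNr addrC subr_eq0 => /eqP.
Qed.

Lemma cb_deriv f f' n : smper f -> smper f' -> deriv f f' ->
  cb f' n = - (2 * pi * n%:~R * ca f n).
Proof.
move=> sf sf' df; have d := derivM df (deriv_sz n).
have s1 : smper (fun x => 2 * pi * n%:~R * (f x * cz n x)).
  by apply: smperM (smper_cst _) (smperM sf (smper_cz n)).
have s2 : smper (fun x => f' x * sz n x) by apply: smperM => //; exact: smper_sz.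
have d' : deriv (fun x => f x * sz n x)
    (fun x => 2 * pi * n%:~R * (f x * cz n x) + f' x * sz n x).
  by apply: deriv_ext d _ => x; ring.
have /eqP := I01_deriv_per d' (smper_continuous (smperD s1 s2))
  (smperM sf (smper_sz n)).2.
rewrite I01D ?I01Z; [|exact: smc|exact: smper_continuous|exact: smper_continuous].
by rewrite addrC addr_eq0 => /eqP.
Qed.

Lemma two_pi_ge1 : 1 <= 2 * pi :> R.
Proof. by have := @pi_ge2 R; lra. Qed.

(** Bounding the frequency below by |n| keeps pi out of all decay constants. *)
Lemma absz_le_freq n : `|n|%N%:R <= `|2 * pi * n%:~R| :> R.
Proof.
rewrite natr_absz intr_norm normrM ler_peMl// ger0_norm ?two_pi_ge1//.
exact: le_trans ler01 two_pi_ge1.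
Qed.

(** Two integrations by parts. The constant is the sup bound of f'' itself, which makes the later
    rates and norm bounds explicit. *)
Lemma fourier_decay2 f f' f'' B : smper f -> smper f' -> smper f'' ->
  deriv f f' -> deriv f' f'' -> (forall x, `|f'' x| <= B) ->
  forall n, `|n|%N%:R ^+ 2 * `|ca f n| <= B /\ `|n|%N%:R ^+ 2 * `|cb f n| <= B.
Proof.
move=> sf sf' sf'' df df' fB n.
have key (w x : R) : `|n|%N%:R <= `|w| -> `|n|%N%:R ^+ 2 * `|x| <= `|w * (w * x)|.
  by move=> nw; rewrite !normrM mulrA expr2 ler_wpM2r// ler_pM.
have e1 : `|n|%N%:R ^+ 2 * `|ca f n| <= `|ca f'' n|.
  by rewrite (ca_deriv n sf' sf'' df') (cb_deriv n sf sf' df) mulrN normrN key// absz_le_freq.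
have e2 : `|n|%N%:R ^+ 2 * `|cb f n| <= `|cb f'' n|.
  by rewrite (cb_deriv n sf' sf'' df') (ca_deriv n sf sf' df) normrN key// absz_le_freq.
by split; [apply: (le_trans e1); exact: ca_le|apply: (le_trans e2); exact: cb_le].
Qed.

(** One integration by parts per power of |n|; each exchanges [ca] and [cb], so the induction
    carries both. *)
Lemma fourier_decay f (k : nat) : smper f ->
  exists2 C : R, 0 <= C & forall n, `|n|%N%:R ^+ k * `|ca f n| <= C /\ `|n|%N%:R ^+ k * `|cb f n| <= C.
Proof.
elim: k f => [|k IH] f sf.
  have [B B0 hB] := smper_bounded sf; exists B => [|n]; first exact: ltW.
  by rewrite !expr0 !mul1r; split; [exact: ca_le|exact: cb_le].
have [f' df sf'] := smper_deriv sf; have [C C0 hC] := IH _ sf'.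
exists C => // n; have [hc hs] := hC n; split.
  apply: le_trans hs; rewrite (cb_deriv n sf sf' df) normrN normrM exprSr -mulrA.
  by rewrite ler_wpM2l ?exprn_ge0// ler_wpM2r// absz_le_freq.
apply: le_trans hc; rewrite (ca_deriv n sf sf' df) normrM exprSr -mulrA.
by rewrite ler_wpM2l ?exprn_ge0// ler_wpM2r// absz_le_freq.
Qed.

(** The real part of f_n e^(2 i pi n y), where f_n is [ca f n] minus i times [cb f n]. The imaginary
    part is odd in n and cancels in symmetric sums. *)
Definition fterm f n y := ca f n * cz n y + cb f n * sz n y.
Definition fsum f N y := \sum_(n <- zrange N) fterm f n y.

Lemma ftermN f n y : smper f -> fterm f (- n) y = fterm f n y.
Proof. by move=> sf; rewrite /fterm caN cbN// czN szN mulrNN. Qed.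

Lemma smper_sum (T : Type) (r : seq T) (F : T -> R -> R) :
  (forall i, smper (F i)) -> smper (fun x => \sum_(i <- r) F i x).
Proof.
move=> sF; elim: r => [|i r IH].
  by under eq_fun do rewrite big_nil; exact: smper_cst.
by under eq_fun do rewrite big_cons; exact: smperD.
Qed.

Lemma smper_fterm f n : smper (fterm f n).
Proof.
by apply: smperD; apply: smperM (smper_cst _) _; [exact: smper_cz|exact: smper_sz].
Qed.

Lemma smper_fsum f N : smper (fsum f N).
Proof. by apply: smper_sum => n; exact: smper_fterm. Qed.

Lemma deriv_sum (T : Type) (r : seq T) (F F' : T -> R -> R) :
  (forall i, deriv (F i) (F' i)) ->
  deriv (fun x => \sum_(i <- r) F i x) (fun x => \sum_(i <- r) F' i x).
Proof.
move=> dF; elim: r => [|i r IH].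
  by under eq_fun do rewrite big_nil; apply: deriv_ext (deriv_cst _) _ => x; rewrite big_nil.
under eq_fun do rewrite big_cons; apply: deriv_ext (derivD (dF i) IH) _ => x.
by rewrite big_cons.
Qed.

(** Thanks to this, approximating f' and f'' by the derivatives of [fsum f N] is the same problem as
    approximating them by their own partial sums. *)
Lemma deriv_fsum f f' N : smper f -> smper f' -> deriv f f' -> deriv (fsum f N) (fsum f' N).
Proof.
move=> sf sf' df; apply: deriv_sum => n.
have dc := derivM (deriv_cst (ca f n)) (deriv_cz n).
have ds := derivM (deriv_cst (cb f n)) (deriv_sz n).
apply: deriv_ext (derivD dc ds) _ => x /=.
by rewrite /fterm (ca_deriv n sf sf' df) (cb_deriv n sf sf' df); ring.
Qed.

Lemma fterm_bound f B : (forall n, `|n|%N%:R ^+ 2 * `|ca f n| <= B /\ `|n|%N%:R ^+ 2 * `|cb f n| <= B) ->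
  forall n y, n != 0 -> `|fterm f n y| <= 2 * B / `|n|%N%:R ^+ 2.
Proof.
move=> hB n y n0; have [h1 h2] := hB n.
have p0 : 0 < `|n|%N%:R ^+ 2 :> R by rewrite exprn_gt0// ltr0n absz_gt0.
rewrite ler_pdivlMr//.
have h : `|fterm f n y| <= `|ca f n| + `|cb f n|.
  apply: (le_trans (ler_normD _ _)); rewrite !normrM.
  by apply: lerD; rewrite ler_piMr// ?normr_cz ?normr_sz.
apply: (le_trans (ler_wpM2r (ltW p0) h)).
by rewrite mulrC mulrDr; lra.
Qed.

End Fourier.

(** * Fourier inversion *)

Section Fejer.
Context {R : realType}.
Implicit Types (f g : R -> R) (n : int) (N : nat) (t x y B : R).

Lemma zsum_even (F : int -> R) N : (forall n, F (- n) = F n) ->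
  \sum_(n <- zrange N) F n = F 0 + 2 * \sum_(j < N) F j.+1.
Proof.
move=> eF; elim: N => [|N IH]; first by rewrite zsum0 big_ord0 mulr0 addr0.
by rewrite zsumS IH big_ord_recr /= eF; ring.
Qed.

(** A sum of Dirichlet kernels, that is N times the usual Fejer kernel; leaving it unnormalised
    avoids division. *)
Definition fejer N (t : R) := \sum_(m < N) \sum_(n <- zrange m) cz n t.

(** Adding w^N to the sum of the w^j, j < N, changes its squared modulus by 1 plus cross terms, and
    this increment is the Dirichlet kernel of order N. *)
Lemma fejerE N t :
  fejer N t = (\sum_(j < N) cz j t) ^+ 2 + (\sum_(j < N) sz j t) ^+ 2.
Proof.
rewrite /fejer; elim: N => [|N IH]; first by rewrite !big_ord0 expr0n addr0.
rewrite !big_ord_recr /= IH zsum_even; last by move=> n; rewrite czN.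
have -> : \sum_(j < N) cz j.+1 t =
    cz N t * (\sum_(j < N) cz j t) + sz N t * (\sum_(j < N) sz j t).
  (* Reversing the order of summation turns j + 1 into N - j, to which the addition formula
     applies. *)
  rewrite !mulr_sumr -big_split /= (reindex_inj rev_ord_inj); apply: eq_bigr => j _ /=.
  rewrite (_ : (N - j.+1).+1%:Z = N%:Z - j%:Z); last by have := ltn_ord j; lia.
  by rewrite czD czN szN mulrN opprK.
rewrite cz0; have := cz2Dsz2 N t; lra.
Qed.

Lemma fejer_ge0 N t : 0 <= fejer N t.
Proof. by rewrite fejerE addr_ge0// sqr_ge0. Qed.

(* [2 - 2 cos(2 pi t) = |w - 1|^2] and [fejer N t = |\sum_(j < N) w^j|^2] for
   [w = e^(2 i pi t)], a geometric sum. *)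
Lemma fejer_bound N t : (1 - cz 1 t) * fejer N t <= 2.
Proof.
set c := \sum_(j < N) cz j t; set s := \sum_(j < N) sz j t.
have [e1 e2] : (cz 1 t - 1) * c - sz 1 t * s = cz N t - 1 /\
               (cz 1 t - 1) * s + sz 1 t * c = sz N t.
  rewrite /c /s; elim: N {c s} => [|N [e1 e2]].
    by rewrite !big_ord0 cz0 sz0; split; ring.
  have eN : (N.+1 = N%:Z + 1 :> int) by rewrite -addn1 PoszD.
  rewrite !big_ord_recr /= eN czD szD.
  set c := \sum_(j < N) _ in e1 e2 *; set s := \sum_(j < N) _ in e1 e2 *.
  by split; lra.
have h1 := cz2Dsz2 1 t; have hN := cz2Dsz2 N t.
have e : ((cz 1 t - 1) ^+ 2 + sz 1 t ^+ 2) * (c ^+ 2 + s ^+ 2) = (cz N t - 1) ^+ 2 + sz N t ^+ 2.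
  by rewrite -e1 -e2; ring.
have h1' : (cz 1 t - 1) ^+ 2 + sz 1 t ^+ 2 = 2 * (1 - cz 1 t) by lra.
have hN' : (cz N t - 1) ^+ 2 + sz N t ^+ 2 = 2 * (1 - cz N t) by lra.
rewrite h1' hN' in e.
rewrite fejerE -/c -/s; have : - 1 <= cz N t by exact: cos_geN1.
lra.
Qed.

Lemma smper_refl f (y : R) : smper f -> smper (fun t => f (y - t)).
Proof.
move=> [sf pf]; split=> [|x].
  have := smooth_comp sf (smooth_lin (-1) y).
  by under [in X in X -> _]eq_fun do rewrite mulN1r addrC.
by rewrite -[LHS]pf opprD addrA subrK.
Qed.

Lemma I01_fterm f n y : smper f -> I01 (fun t => f t * cz n (y - t)) = fterm f n y.
Proof.
move=> sf; rewrite /fterm [ca f n * _]mulrC [cb f n * _]mulrC.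
have c1 : smper (fun t => f t * cz n t) := smperM sf (smper_cz n).
have c2 : smper (fun t => f t * sz n t) := smperM sf (smper_sz n).
rewrite /ca /cb -I01Z -?I01Z; [|exact: smper_continuous|exact: smper_continuous].
rewrite -I01D; [|exact/smper_continuous/smperM/c1/smper_cst|exact/smper_continuous/smperM/c2/smper_cst].
by congr I01; apply/funext => t; rewrite czB_arg; ring.
Qed.

Lemma smper_fejer N y : smper (fun t => fejer N (y - t)).
Proof. by apply: smper_sum => m; apply: smper_sum => n; exact/smper_refl/smper_cz. Qed.

Lemma I01_fejer f N y : smper f ->
  I01 (fun t => f t * fejer N (y - t)) = \sum_(m < N) fsum f m y.
Proof.
move=> sf.
have sfc n : smper (fun t => f t * cz n (y - t)).
  by apply: smperM => //; exact/smper_refl/smper_cz.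
have E m : fsum f m y = I01 (fun t => \sum_(n <- zrange m) f t * cz n (y - t)).
  rewrite I01_sum; last by move=> n; exact: smper_continuous.
  by apply: eq_bigr => n _; rewrite I01_fterm.
under [RHS]eq_bigr do rewrite E.
rewrite -(I01_sum (index_enum 'I_N) (F := fun (m : 'I_N) t =>
  \sum_(n <- zrange m) f t * cz n (y - t))); last first.
  by move=> m; apply/smper_continuous/smper_sum.
congr I01; apply/funext => t; rewrite /fejer mulr_sumr; apply: eq_bigr => m _.
by rewrite mulr_sumr.
Qed.

(** The constant 1 has derivative 0, so integration by parts shows that both coefficients vanish
    after multiplication by 2 pi n. *)
Lemma ca_cb_cst1 n : n != 0 -> ca (fun _ : R => 1) n = 0 /\ cb (fun _ : R => 1) n = 0.
Proof.
move=> n0.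
have sc (c : R) : smper (fun _ : R => c) := smper_cst c.
have z0 : I01 (fun _ : R => 0) = 0 by exact: I01_cst.
have hc := ca_deriv n (sc 1) (sc 0) (deriv_cst _).
have hs := cb_deriv n (sc 1) (sc 0) (deriv_cst _).
have w0 : 2 * pi * n%:~R != 0 :> R by rewrite !mulf_neq0// ?intr_eq0// gt_eqF// pi_gt0.
split; apply: (mulfI w0); rewrite mulr0.
  by apply/eqP; rewrite -oppr_eq0 -hs /cb; under eq_fun do rewrite mul0r; rewrite z0.
by rewrite -hc /ca; under eq_fun do rewrite mul0r; rewrite z0.
Qed.

Lemma ca_cb_cst0 : ca (fun _ : R => 1) 0 = 1 /\ cb (fun _ : R => 1) 0 = 0.
Proof.
rewrite /ca /cb; split.
  by under eq_fun do rewrite cz0 mul1r; exact: I01_cst.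
by under eq_fun do rewrite sz0 mulr0; exact: I01_cst.
Qed.

Lemma fsum_cst1 m y : fsum (fun _ : R => 1) m y = 1.
Proof.
rewrite /fsum (bigD1_seq 0) ?zrange_uniq ?mem_zrange//=; last by apply/andP; split; lia.
rewrite big1 ?addr0 => [|n n0]; have [h1 h2] := ca_cb_cst0; rewrite /fterm.
  by rewrite h1 h2 cz0 mulr1 mul0r addr0.
by have [-> ->] := ca_cb_cst1 n0; rewrite !mul0r addr0.
Qed.

Lemma I01_fejer1 N y : I01 (fun t => fejer N (y - t)) = N%:R.
Proof.
have := I01_fejer N y (smper_cst 1).
under eq_fun do rewrite mul1r.
by move=> ->; under eq_bigr do rewrite fsum_cst1; rewrite sumr_const card_ord.
Qed.

(** On [0, 1] the function cos(2 pi r) decreases up to 1/2 and is symmetric about 1/2. *)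
Lemma cz1_lt (d r : R) : 0 < d -> d <= r -> r <= 1 - d -> cz 1 r <= cz 1 d.
Proof.
move=> d0 dr rd; have p0 := @pi_gt0 R.
have cosle (a b : R) : 0 < a -> a <= b -> b <= 1 / 2 -> cz 1 b <= cz 1 a.
  move=> a0 ab b1; rewrite /cz !mul1r leNgt ltr_cos ?in_itv/=.
  - by rewrite -leNgt ler_pM2l//; lra.
  - by apply/andP; split; [apply: mulr_ge0; lra|nra].
  - by apply/andP; split; [apply: mulr_ge0; lra|nra].
have [r1|r1] := leP r (1 / 2); first exact: cosle.
have -> : cz 1 r = cz 1 (1 - r).
  by rewrite -czN -[RHS](per_int (-1) _ (smper_cz 1).2) /cz; congr cos; ring.
by apply: cosle => //; lra.
Qed.

(** Near y modulo 1, continuity gives the bound e. Elsewhere 1 - cos(2 pi (y - t)) is bounded below,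
    so a large multiple of it exceeds the crude bound 2B. *)
Lemma korovkin f (y e : R) : smper f -> 0 < e ->
  exists2 C : R, 0 <= C & forall t, `|f t - f y| <= e + C * (1 - cz 1 (y - t)).
Proof.
move=> sf e0; have [B B0 fB] := smper_bounded sf.
have /cvgrPdist_le /(_ e e0) := @smper_continuous R f sf y.
rewrite -near_nbhs => /nbhs_ballP [d0 /= d00 hd0].
pose d := Num.min (d0 / 2) (1 / 4).
have d0' : 0 < d by rewrite lt_min; apply/andP; split; lra.
have dd0 : d < d0 by rewrite gt_min; apply/orP; left; lra.
have d4 : d <= 1 / 4 by rewrite ge_min lexx orbT.
have hd t : `|t - y| <= d -> `|f t - f y| <= e.
  by move=> h; rewrite distrC; apply: hd0; rewrite /ball /= distrC; apply: le_lt_trans dd0.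
have cd : cz 1 d < 1.
  have p0 := @pi_gt0 R.
  rewrite -(@cos0 R) /cz mul1r ltr_cos ?in_itv/=; first by apply: mulr_gt0; lra.
    by rewrite lexx ltW.
  by apply/andP; split; [apply: mulr_ge0; lra|nra].
exists (2 * B / (1 - cz 1 d)) => [|t].
  by rewrite divr_ge0 ?mulr_ge0 ?subr_ge0 ?ltW//.
have C0 : 0 <= 2 * B / (1 - cz 1 d) by rewrite divr_ge0 ?mulr_ge0 ?subr_ge0 ?ltW//.
have c1 : cz 1 (y - t) <= 1 by exact: cz_le1.
(* By periodicity only the offset r of t from y modulo 1 matters: it is near 0, near 1, or in
   between. *)
pose r := (t - y) - (Num.floor (t - y))%:~R.
have /andP[r0 r1] : 0 <= r < 1 := frac_itv (t - y).
have ft : f t = f (y + r).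
  rewrite (_ : y + r = t + (- Num.floor (t - y))%:~R) ?per_int//; first by case: sf.
  by rewrite /r mulrNz; ring.
have ct : cz 1 (y - t) = cz 1 r.
  by rewrite /r (per_frac _ (smper_cz 1).2) -czN /cz; congr cos; rewrite mulrNz; ring.
have [rd|rd] := leP r d.
  rewrite ft; apply: (le_trans (hd _ _)); first by rewrite addrAC subrr add0r ger0_norm.
  by rewrite lerDl mulr_ge0// subr_ge0.
have [rd'|rd'] := leP (1 - d) r.
  have -> : f t = f (y + (r - 1)).
    by rewrite ft [y + (r - 1)]addrA; case: sf => _ pf; rewrite -[RHS]pf subrK.
  apply: (le_trans (hd _ _)); first by rewrite addrAC subrr add0r ler0_norm; lra.
  by rewrite lerDl mulr_ge0// subr_ge0.
apply: (@le_trans _ _ (2 * B)).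
  by apply: (le_trans (ler_normB _ _)); have := fB t; have := fB y; lra.
have hc : cz 1 (y - t) <= cz 1 d by rewrite ct; apply: cz1_lt => //; exact: ltW.
apply: (@le_trans _ _ (2 * B / (1 - cz 1 d) * (1 - cz 1 d))).
  by rewrite divfK// subr_eq0 gt_eqF.
rewrite -[leLHS]add0r; apply: lerD; first exact: ltW.
by apply: ler_wpM2l => //; rewrite lerD2l lerN2.
Qed.

(** This replaces dividing by N and passing to the limit: an error bounded independently of N is
    harmless. *)
Lemma ler_natmul_cst (a b c : R) : (forall N, N%:R * a <= N%:R * b + c) -> a <= b.
Proof.
move=> h; rewrite leNgt; apply/negP => ba.
have := archi_boundP (normr_ge0 (c / (a - b))); set N := Num.bound _ => hN.
have d0 : 0 < a - b by rewrite subr_gt0.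
have : c < N%:R * (a - b).
  rewrite -ltr_pdivrMr//; apply: le_lt_trans hN; exact: ler_norm.
by have := h N; lra.
Qed.

(** Coefficient decay makes the partial sums at y Cauchy with an explicit rate. Their averages, the
    Fejer means, tend to f y and so identify the limit. *)
Lemma fourier_approx f f' f'' B : smper f -> smper f' -> smper f'' ->
  deriv f f' -> deriv f' f'' -> (forall x, `|f'' x| <= B) ->
  forall N y, `|f y - fsum f N y| <= 8 * B / N.+1%:R.
Proof.
move=> sf sf' sf'' df df' fB N y.
have B0 : 0 <= B := le_trans (normr_ge0 _) (fB 0).
have hd := fourier_decay2 sf sf' sf'' df df' fB.
(* The indices m + 1 and -(m + 1) contribute at most 2B/(m+1)^2 each. *)
have step m : `|fsum f m.+1 y - fsum f m y| <= 4 * B / m.+1%:R ^+ 2.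
  rewrite /fsum zsumS addrAC subrr add0r ftermN//.
  have := fterm_bound hd y (isT : m.+1%:Z != 0); rewrite absz_nat => h.
  by apply: (le_trans (ler_normD _ _)); apply: (le_trans (lerD h h)); rewrite -!mulrDl -natrD.
have tel := inv_sqr_telescope (normr0 _) (@ler_normD _ R) (mulr_ge0 (ler0n _ 4) B0) step.
pose K := 8 * B.
have K0 : 0 <= K by rewrite mulr_ge0.
have tail m : (N <= m)%N -> `|fsum f m y - fsum f N y| <= K / N.+1%:R.
  by move=> /tel; rewrite mulrA -natrM.
have head m : (m <= N)%N -> `|fsum f m y - fsum f N y| <= K.
  rewrite distrC => /tel h; apply: (le_trans h); rewrite mulrA -natrM ler_piMr//.
  by rewrite invf_le1 ?ler1n ?ltr0n.
(* Only the first N partial sums can be far from [fsum f N y]; together they cost at most N K,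
   whatever M is. *)
have hsum M : `|\sum_(m < M) (fsum f m y - fsum f N y)| <= M%:R * (K / N.+1%:R) + N%:R * K.
  apply: (le_trans (ler_norm_sum _ _ _)); elim: M => [|M IH].
    by rewrite big_ord0 mul0r add0r mulr_ge0.
  have [NM|MN] := leqP N M.
    rewrite big_ord_recr /= -natr1 mulrDl mul1r addrAC; exact: lerD IH (tail M NM).
  apply: (@le_trans _ _ (M.+1%:R * K)).
    rewrite mulr_natl -[X in _ *+ X](card_ord M.+1) -sumr_const; apply: ler_sum => m _.
    by apply: head; have := ltn_ord m; lia.
  rewrite ler_wpDl ?mulr_ge0 ?divr_ge0//.
  by rewrite ler_wpM2r// ler_nat.
apply/ler_addgt0Pr => e e0.
have [C C0 hC] := korovkin y sf e0.
apply: (@ler_natmul_cst _ _ (2 * C + N%:R * K)) => M.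
have -> : M%:R * `|f y - fsum f N y| = `|M%:R * f y - \sum_(m < M) fsum f m y +
    \sum_(m < M) (fsum f m y - fsum f N y)|.
  rewrite -[in LHS](@ger0_norm _ M%:R)// -normrM; congr (`|_|).
  rewrite big_split /= addrA subrK sumr_const card_ord mulNrn; by rewrite -[fsum f N y *+ M]mulr_natl mulrBr.
apply: (le_trans (ler_normD _ _)).
(* Integrating the estimate of [korovkin] against the kernel turns its weight into at most 2C for
   every M, by [fejer_bound]. *)
suff : `|M%:R * f y - \sum_(m < M) fsum f m y| <= M%:R * e + 2 * C.
  move=> h; apply: (le_trans (lerD h (hsum M))).
  by rewrite le_eqVlt; apply/orP; left; apply/eqP; rewrite /K; ring.
have sF := smper_fejer M y.
have -> : M%:R * f y - \sum_(m < M) fsum f m y = I01 (fun t => (f y - f t) * fejer M (y - t)).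
  rewrite -I01_fejer// -(I01_fejer1 M y) mulrC -I01Z; last exact: smper_continuous.
  rewrite -mulN1r -I01Z; last exact/smper_continuous/smperM.
  rewrite -I01D; first by congr I01; apply/funext => t; ring.
    exact/smper_continuous/smperM/sF/smper_cst.
  exact/smper_continuous/smperM/smperM/sF/sf/smper_cst.
have smf : smper (fun t => (f y - f t) * fejer M (y - t)).
  by apply: smperM sF; apply: smperB => //; exact: smper_cst.
have pt t : `|(f y - f t) * fejer M (y - t)| <= e * fejer M (y - t) + 2 * C.
  rewrite normrM distrC (ger0_norm (fejer_ge0 _ _)).
  apply: (le_trans (ler_wpM2r (fejer_ge0 _ _) (hC t))).
  rewrite mulrDl lerD2l -mulrA [2 * C]mulrC ler_wpM2l//; exact: fejer_bound.
have smg : smper (fun t => e * fejer M (y - t) + 2 * C).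
  by apply: smperD (smper_cst _); apply: smperM => //; exact: smper_cst.
have <- : I01 (fun t => e * fejer M (y - t) + 2 * C) = M%:R * e + 2 * C.
  rewrite I01D; [|exact: (smper_continuous (smperM (smper_cst e) sF))|].
    rewrite I01_cst I01Z; last exact: (smper_continuous sF).
    by rewrite I01_fejer1 [e * _]mulrC.
  exact: (smper_continuous (smper_cst (2 * C))).
have cF := smper_continuous smf; have cG := smper_continuous smg.
rewrite ler_norml; apply/andP; split.
  rewrite -mulN1r -I01Z//; apply: I01_le => [||t].
  - exact: (smper_continuous (smperM (smper_cst (-1)) smg)).
  - exact: cF.
  - by have := pt t; rewrite ler_norml mulN1r => /andP[].
by apply: I01_le => [||t]; [exact: cF|exact: cG|have := pt t; rewrite ler_norml => /andP[]].
Qed.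

End Fejer.

(** * Translation invariance of the integral over a period *)

Section Translation.
Context {R : realType}.
Implicit Types (f g : R -> R) (n : int) (N : nat) (s x y B : R).

(** For a translated partial Fourier sum only the constant term has a nonzero integral; uniform
    approximation then carries the invariance over to f. *)
Lemma I01_translate f s : smper f -> I01 (fun x => f (x + s)) = I01 f.
Proof.
move=> sf; have [f' df sf'] := smper_deriv sf; have [f'' df' sf''] := smper_deriv sf'.
have [B B0 fB] := smper_bounded sf''.
have happ := fourier_approx sf sf' sf'' df df' fB.
have trunc N : I01 (fun x => fsum f N (x + s)) = I01 f.
  have Z n : n != 0 -> I01 (fun x => fterm f n (x + s)) = 0.
    move=> /(@ca_cb_cst1 R) [h1 h2].
    pose a := ca f n * cz n s + cb f n * sz n s.
    pose b := cb f n * cz n s - ca f n * sz n s.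
    have -> : (fun x => fterm f n (x + s)) = (fun x => a * (1 * cz n x) + b * (1 * sz n x)).
      by apply/funext => x; rewrite /fterm czD_arg szD_arg /a /b; ring.
    have c1 : smper (fun x => 1 * cz n x) := smperM (smper_cst 1) (smper_cz n).
    have c2 : smper (fun x => 1 * sz n x) := smperM (smper_cst 1) (smper_sz n).
    rewrite I01D; [|exact: (smper_continuous (smperM (smper_cst _) c1))
                   |exact: (smper_continuous (smperM (smper_cst _) c2))].
    rewrite (I01Z a (smper_continuous c1)) (I01Z b (smper_continuous c2)).
    by rewrite -/(ca (fun=> 1) n) -/(cb (fun=> 1) n) h1 h2 !mulr0 addr0.
  rewrite /fsum I01_sum; last first.
    by move=> n; exact: (smper_continuous (smper_shift s (smper_fterm f n))).
  rewrite (bigD1_seq 0) ?zrange_uniq ?mem_zrange//=; last by apply/andP; split; lia.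
  rewrite big1 ?addr0 => [|n /Z//].
  under eq_fun do rewrite /fterm cz0 sz0 mulr0 addr0 mulr1.
  by rewrite I01_cst /ca; congr I01; apply/funext => x; rewrite cz0 mulr1.
apply/eqP; rewrite -subr_eq0 -normr_le0.
apply: (@ler_natmul_cst _ _ _ (8 * B)) => N; rewrite mulr0 add0r.
rewrite -[X in _ * `|_ - X|](trunc N).
have -> : I01 (fun x => f (x + s)) - I01 (fun x => fsum f N (x + s)) =
          I01 (fun x => f (x + s) - fsum f N (x + s)).
  rewrite -mulN1r -I01Z; last exact: (smper_continuous (smper_shift s (smper_fsum f N))).
  rewrite -I01D; first by congr I01; apply/funext => x; rewrite mulN1r.
    exact: (smper_continuous (smper_shift s sf)).
  exact: (smper_continuous (smperM (smper_cst _) (smper_shift s (smper_fsum f N)))).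
have : `|I01 (fun x => f (x + s) - fsum f N (x + s))| <= 8 * B / N.+1%:R.
  apply: I01_norm => [|x]; last exact: happ.
  exact: (smper_continuous (smperB (smper_shift s sf) (smper_shift s (smper_fsum f N)))).
rewrite ler_pdivlMr ?ltr0n// mulrC; apply: le_trans.
by rewrite ler_wpM2r// ler_nat.
Qed.

Lemma ca_cb_shift f n s : smper f ->
  ca (fun x => f (x + s)) n = cz n s * ca f n + sz n s * cb f n /\
  cb (fun x => f (x + s)) n = cz n s * cb f n - sz n s * ca f n.
Proof.
move=> sf.
have c1 : smper (fun x => f x * cz n x) := smperM sf (smper_cz n).
have c2 : smper (fun x => f x * sz n x) := smperM sf (smper_sz n).
have comb (a b : R) (h : R -> R) : (forall x, h x = a * (f x * cz n x) + b * (f x * sz n x)) ->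
    I01 (fun x => h (x + s)) = a * ca f n + b * cb f n.
  move=> /funext ->.
  have k1 := smperM (smper_cst a) c1; have k2 := smperM (smper_cst b) c2.
  rewrite (I01_translate s (smperD k1 k2)) I01D; [|exact: (smper_continuous k1)|exact: (smper_continuous k2)].
  by rewrite (I01Z a (smper_continuous c1)) (I01Z b (smper_continuous c2)).
split.
  rewrite -(comb _ _ (fun x => f x * cz n (x - s))); last by move=> x; rewrite czB_arg; ring.
  by rewrite /ca; congr I01; apply/funext => x; rewrite addrK.
rewrite addrC -mulNr -(comb _ _ (fun x => f x * sz n (x - s))); last first.
  by move=> x; rewrite szD_arg -[- s]mul1r mulNr -mulrN /cz /sz !mulrN cosN sinN !mul1r; ring.
by rewrite /cb; congr I01; apply/funext => x; rewrite addrK.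
Qed.

End Translation.

(** * Norm, unitaries and convergence in a C*-algebra *)

Section CStarBasics.
Context {R : realType} {A : cstarAlgType R}.
Implicit Types (x y z u : A) (a b : R[i]) (r B : R).

Definition rc (r : R) : R[i] := (r%:C)%C.
Definition ii : R[i] := (0 +i* 1)%C.

Lemma iiM : ii * ii = -1.
Proof. by rewrite /ii; apply/eqP; rewrite eq_complex /= ; apply/andP; split; apply/eqP; ring. Qed.

Lemma rcM r s : rc (r * s) = rc r * rc s.
Proof. exact: rmorphM. Qed.
Lemma rcD r s : rc (r + s) = rc r + rc s.
Proof. exact: rmorphD. Qed.
Lemma rcN r : rc (- r) = - rc r.
Proof. exact: rmorphN. Qed.
Lemma rc0 : rc 0 = 0. Proof. by []. Qed.
Lemma rc1 : rc 1 = 1. Proof. by []. Qed.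

Lemma complexRI r s : (r +i* s)%C = rc r + ii * rc s.
Proof. by apply/eqP; rewrite eq_complex /=; apply/andP; split; apply/eqP; ring. Qed.

(** The modulus as an element of R: [cnorm] is real-valued, whereas the norm of R[i] takes its
    values in R[i]. *)
Definition cabs (a : R[i]) : R := Num.sqrt (complex.Re a ^+ 2 + complex.Im a ^+ 2).

Lemma cabsE a : `|a| = rc (cabs a).
Proof. exact: normc_def. Qed.

Lemma cabsM a b : cabs (a * b) = cabs a * cabs b.
Proof. by apply: (@complexI R); rewrite -[LHS]cabsE normrM !cabsE -rcM. Qed.

Lemma cabs_ge0 a : 0 <= cabs a. Proof. exact: sqrtr_ge0. Qed.

Lemma cabs_le a : cabs a <= `|complex.Re a| + `|complex.Im a|.
Proof.
have p := addr_ge0 (normr_ge0 (complex.Re a)) (normr_ge0 (complex.Im a)).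
rewrite -(ger0_norm p) -sqrtr_sqr ler_sqrt ?sqr_ge0// sqrrD !real_normK ?num_real//.
by rewrite addrAC lerDl mulrn_wge0// mulr_ge0.
Qed.

Lemma cabs_rc r : cabs (rc r) = `|r|.
Proof. by rewrite /cabs /= expr0n addr0 sqrtr_sqr. Qed.

Lemma cnormZE a x : cnorm (a *: x) = cabs a * cnorm x.
Proof. by apply: (@complexI R); rewrite cnormZ cabsE -rcM. Qed.

Lemma cnorm0 : cnorm (0 : A) = 0.
Proof. by rewrite -(scale0r 0) cnormZE -[0]rc0 cabs_rc normr0 mul0r. Qed.

Lemma cnormN x : cnorm (- x) = cnorm x.
Proof. by rewrite -scaleN1r cnormZE -rc1 -rcN cabs_rc normrN normr1 mul1r. Qed.

Lemma cnorm_ge0 x : 0 <= cnorm x.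
Proof. by have := cnormD_le x (- x); rewrite subrr cnorm0 cnormN -mulr2n pmulrn_lge0. Qed.

Lemma cnormB x y : cnorm (x - y) = cnorm (y - x).
Proof. by rewrite -cnormN opprB. Qed.

Lemma cnorm_sum (T : Type) (r : seq T) (P : pred T) (F : T -> A) :
  cnorm (\sum_(i <- r | P i) F i) <= \sum_(i <- r | P i) cnorm (F i).
Proof.
elim/big_ind2: _ => [|x a y b h1 h2|//]; first by rewrite cnorm0.
exact: le_trans (cnormD_le _ _) (lerD h1 h2).
Qed.

Lemma starD x y : star (x + y) = star x + star y.
Proof. by have := star_semilinear 1 x y; rewrite scale1r rmorph1 scale1r. Qed.

Lemma star0 : star (0 : A) = 0.
Proof. by apply: (addrI (star 0)); rewrite -starD !addr0. Qed.

Lemma starZ a x : star (a *: x) = a^* *: star x.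
Proof. by have := star_semilinear a x 0; rewrite !addr0 star0 addr0. Qed.

Lemma star1 : star (1 : A) = 1.
Proof. by rewrite -[LHS]mul1r -{1}[1]starK -starM mul1r starK. Qed.

Lemma starN x : star (- x) = - star x.
Proof. by apply: (addrI (star x)); rewrite -starD !subrr star0. Qed.

Lemma star_sum (T : Type) (r : seq T) (F : T -> A) :
  star (\sum_(i <- r) F i) = \sum_(i <- r) star (F i).
Proof. by elim/big_rec2: _ => [|i y x _ <-]; rewrite ?star0 ?starD. Qed.

(** The C*-identity and submultiplicativity bound the square of the norm of y by the norm of
    [star y] times that of y; divide, then exchange y and [star y]. *)
Lemma cnorm_star x : cnorm (star x) = cnorm x.
Proof.
have h y : cnorm y <= cnorm (star y).
  have [->|y0] := eqVneq (cnorm y) 0; first exact: cnorm_ge0.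
  have yp : 0 < cnorm y by rewrite lt_neqAle eq_sym y0 cnorm_ge0.
  by rewrite -(ler_pM2r yp) -expr2 -cstar_identity; exact: cnormM_le.
by apply/eqP; rewrite eq_le h andbT -[X in _ <= cnorm X]starK.
Qed.

Lemma cnorm1 : cnorm (1 : A) = 1.
Proof.
have := cstar_identity (1 : A); rewrite star1 mulr1 expr2 => /eqP.
rewrite -{1}[cnorm 1]mulr1 -subr_eq0 -mulrBr mulf_eq0 subr_eq0 => /orP[/eqP h|/eqP //].
by have := oner_neq0 A; rewrite (cnorm0_eq0 _ h) eqxx.
Qed.

Lemma cnorm_unitary u : unitary u -> cnorm u = 1.
Proof.
move=> [h _]; have := cstar_identity u; rewrite h cnorm1 => /esym/eqP.
by rewrite sqrf_eq1 => /orP[/eqP //|/eqP e]; have := cnorm_ge0 u; rewrite e ler0N1.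
Qed.

Lemma unitary_star u : unitary u -> unitary (star u).
Proof. by move=> [h1 h2]; split; rewrite starK. Qed.

Lemma unitary1 : unitary (1 : A).
Proof. by rewrite /unitary star1 mulr1. Qed.

Lemma unitaryM u v : unitary u -> unitary v -> unitary (u * v).
Proof.
move=> [u1 u2] [v1 v2]; split; rewrite starM.
  by rewrite mulrA -(mulrA (star v)) u1 mulr1.
by rewrite mulrA -(mulrA u) v2 mulr1.
Qed.

Lemma cnorm_unitaryM u x : unitary u -> cnorm (u * x) <= cnorm x.
Proof. by move=> /cnorm_unitary h; rewrite -[leRHS]mul1r -h; exact: cnormM_le. Qed.

Lemma cnorm_Munitary u x : unitary u -> cnorm (x * u) <= cnorm x.
Proof. by move=> /cnorm_unitary h; rewrite -[leRHS]mulr1 -h; exact: cnormM_le. Qed.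

Lemma upowS u (m : int) : unitary u -> upow u (m + 1) = u * upow u m.
Proof.
move=> [h1 h2]; case: m => k.
  by rewrite -PoszD addn1 /= exprS.
case: k => [|k]; first by rewrite /= expr1 h2.
have -> : Negz k.+1 + 1 = Negz k by lia.
by rewrite /upow [star u ^+ k.+2]exprS mulrA h2 mul1r.
Qed.

Lemma upowP u (m : int) : unitary u -> upow u (m - 1) = star u * upow u m.
Proof. by move=> uu; rewrite -{2}[m](subrK 1) upowS// mulrA uu.1 mul1r. Qed.

Lemma upowD u (m n : int) : unitary u -> upow u (m + n) = upow u m * upow u n.
Proof.
move=> uu; elim/int_rect: m => [|m IH|m IH]; first by rewrite add0r /= expr0 mul1r.
  by rewrite -addn1 PoszD addrAC !upowS// IH mulrA.
by rewrite -addn1 PoszD opprD addrAC !upowP// IH mulrA.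
Qed.

Lemma upow0 u : upow u 0 = 1. Proof. by []. Qed.
Lemma upow1 u : upow u 1 = u. Proof. by rewrite /= expr1. Qed.
Lemma star_upow u (m : int) : unitary u -> star (upow u m) = upow u (- m).
Proof.
move=> uu; have key k : star (upow u k) * upow u k = 1.
  elim/int_rect: k => [|k IH|k IH]; first by rewrite /= star1 mulr1.
    by rewrite -addn1 PoszD upowS// starM mulrA -(mulrA _ (star u)) uu.1 mulr1.
  by rewrite -addn1 PoszD opprD upowP// starM starK mulrA -(mulrA _ u) uu.2 mulr1.
by rewrite -[LHS]mulr1 -(upow0 u) -(subrr m) upowD// mulrA key mul1r.
Qed.

Lemma unitary_upow u (m : int) : unitary u -> unitary (upow u m).
Proof. by move=> uu; rewrite /unitary star_upow// -!upowD// addNr subrr. Qed.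

Definition ncvg (w : nat -> A) x := forall e : R, 0 < e ->
  exists N, forall n, (N <= n)%N -> cnorm (w n - x) <= e.

Lemma norm_cvgP w x : norm_cvg w x <-> ncvg w x.
Proof.
split=> [h e e0|h].
  have /cvgrPdist_le /(_ e e0) [N _ hN] := h.
  by exists N => n /hN; rewrite sub0r normrN ger0_norm// cnorm_ge0.
apply/cvgrPdist_le => e e0; have [N hN] := h e e0.
by exists N => // n /= /hN; rewrite sub0r normrN ger0_norm// cnorm_ge0.
Qed.

Lemma ncvg_uniq w x y : ncvg w x -> ncvg w y -> x = y.
Proof.
move=> hx hy; apply/eqP; rewrite -subr_eq0; apply/eqP/cnorm0_eq0; apply/eqP.
rewrite eq_le cnorm_ge0 andbT; apply/ler_addgt0Pr => e e0; rewrite add0r.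
have e2 : 0 < e / 2 by rewrite divr_gt0.
have [N1 h1] := hx _ e2; have [N2 h2] := hy _ e2.
have := h1 _ (leq_maxl N1 N2); have := h2 _ (leq_maxr N1 N2).
set n := maxn _ _ => k2 k1; rewrite (_ : x - y = (x - w n) + (w n - y)); last by rewrite addrA subrK.
by apply: (le_trans (cnormD_le _ _)); rewrite (cnormB x); lra.
Qed.

Lemma ncvg_cst x : ncvg (fun=> x) x.
Proof. by move=> e e0; exists 0%N => n _; rewrite subrr cnorm0 ltW. Qed.

Lemma ncvgD w w' x y : ncvg w x -> ncvg w' y -> ncvg (fun n => w n + w' n) (x + y).
Proof.
move=> hx hy e e0; have e2 : 0 < e / 2 by rewrite divr_gt0.
have [N1 h1] := hx _ e2; have [N2 h2] := hy _ e2.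
exists (maxn N1 N2) => n; rewrite geq_max => /andP[/h1 k1 /h2 k2].
by rewrite opprD addrACA; apply: (le_trans (cnormD_le _ _)); lra.
Qed.

(** Only additivity is asked of L, so that the conjugate-linear [star] is covered along with scaling
    and multiplication. *)
Lemma ncvg_map (L : A -> A) (C : R) w x : (forall y z, L (y - z) = L y - L z) ->
  (forall y, cnorm (L y) <= C * cnorm y) -> ncvg w x -> ncvg (fun n => L (w n)) (L x).
Proof.
move=> LB LC hw e e0.
have C0 : 0 < `|C| + 1 by rewrite ltr_wpDl.
have [N hN] := hw _ (divr_gt0 e0 C0); exists N => n /hN h.
rewrite -LB; apply: (le_trans (LC _)); apply: (@le_trans _ _ ((`|C| + 1) * cnorm (w n - x))).
  by rewrite ler_wpM2r ?cnorm_ge0// (le_trans (ler_norm C))// lerDl.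
by rewrite mulrC -ler_pdivlMr.
Qed.

Lemma ncvgZ a w x : ncvg w x -> ncvg (fun n => a *: w n) (a *: x).
Proof.
apply: (@ncvg_map (fun y => a *: y) (cabs a)) => y; first by move=> z; rewrite scalerBr.
by rewrite cnormZE.
Qed.

Lemma ncvgMl z w x : ncvg w x -> ncvg (fun n => z * w n) (z * x).
Proof.
apply: (@ncvg_map (fun y => z * y) (cnorm z)) => y; first by move=> y'; rewrite mulrBr.
exact: cnormM_le.
Qed.

Lemma ncvgMr z w x : ncvg w x -> ncvg (fun n => w n * z) (x * z).
Proof.
apply: (@ncvg_map (fun y => y * z) (cnorm z)) => y; first by move=> y'; rewrite mulrBl.
by rewrite mulrC; exact: cnormM_le.
Qed.

Lemma ncvg_star w x : ncvg w x -> ncvg (fun n => star (w n)) (star x).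
Proof.
apply: (@ncvg_map (@star R A) 1) => y; first by move=> z; rewrite starD starN.
by rewrite cnorm_star mul1r.
Qed.

Lemma small_inv (C e : R) : 0 < e -> exists N, forall n, (N <= n)%N -> C / n.+1%:R <= e.
Proof.
move=> e0; have h := archi_boundP (normr_ge0 (C / e)).
exists (Num.bound `|C / e|) => n hn.
rewrite ler_pdivrMr ?ltr0n// mulrC -ler_pdivrMr//.
apply: (le_trans (ler_norm _)); apply/ltW/(lt_le_trans h).
by rewrite ler_nat (leq_trans hn).
Qed.

Lemma ncvg_near (C : R) w w' x : (forall n, cnorm (w' n - w n) <= C / n.+1%:R) ->
  ncvg w x -> ncvg w' x.
Proof.
move=> hC hw e e0; have e2 : 0 < e / 2 by rewrite divr_gt0.
have [N1 h1] := hw _ e2; have [N2 h2] := small_inv C e2.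
exists (maxn N1 N2) => n; rewrite geq_max => /andP[/h1 k1 /h2 k2].
rewrite (_ : w' n - x = (w' n - w n) + (w n - x)); last by rewrite addrA subrK.
by apply: (le_trans (cnormD_le _ _)); apply: (le_trans (lerD (le_trans (hC n) k2) k1)); lra.
Qed.

Lemma ncvg_bound w x y (B : R) : ncvg w x -> (forall n, cnorm (w n - y) <= B) -> cnorm (x - y) <= B.
Proof.
move=> hw hB; apply/ler_addgt0Pr => e e0; have [N h] := hw _ e0.
rewrite (_ : x - y = (x - w N) + (w N - y)); last by rewrite addrA subrK.
by apply: (le_trans (cnormD_le _ _)); rewrite addrC (cnormB x) lerD// h.
Qed.

Lemma ncvg_telescope w (B : R) : 0 <= B ->
  (forall N, cnorm (w N.+1 - w N) <= B / N.+1%:R ^+ 2) -> exists x, ncvg w x.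
Proof.
move=> B0 hw.
have tel := inv_sqr_telescope cnorm0 (@cnormD_le R A) B0 hw.
suff : exists x, norm_cvg w x by move=> [x /norm_cvgP hx]; exists x.
apply: cnorm_complete => e e0.
have e2 : 0 < e / 3 by rewrite divr_gt0.
have [N hN] := small_inv (2 * B) e2; exists N => m n Nm Nn.
rewrite (_ : w m - w n = (w m - w N) + (w N - w n)); last by rewrite addrA subrK.
apply: (le_lt_trans (cnormD_le _ _)); rewrite (cnormB (w N)).
have hNN := hN N (leqnn N).
apply: (le_lt_trans (lerD (le_trans (tel _ _ Nm) hNN) (le_trans (tel _ _ Nn) hNN))); lra.
Qed.

End CStarBasics.

(** * Functional calculus *)

Section ZsumLemmas.
Variable (V : zmodType).
Implicit Types F : int -> V.

Lemma zsum_opp F N : \sum_(n <- zrange N) F (- n) = \sum_(n <- zrange N) F n.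
Proof.
elim: N => [|N IH]; first by rewrite !zsum0 oppr0.
by rewrite !zsumS IH opprK [F (- _) + _]addrC.
Qed.

Lemma zsum_odd F N : F 0 = 0 -> (forall n, F (- n) = - F n) -> \sum_(n <- zrange N) F n = 0.
Proof.
move=> F0 FN; elim: N => [|N IH]; first by rewrite zsum0.
by rewrite zsumS IH FN subrr addr0.
Qed.

End ZsumLemmas.

(** * Complex Fourier coefficients of real functions *)

Section FourierCoef.
Context {R : realType}.
Implicit Types (f g : R -> R) (n k : int) (N : nat).

Definition fc f n : R[i] := (ca f n -i* cb f n)%C.

Lemma fcE f n : fc f n = rc (ca f n) - ii * rc (cb f n).
Proof. by rewrite /fc complexRI rcN mulrN. Qed.

Lemma fourier_coefE f n : smper f -> fourier_coef (fun x => (f x)%:C)%C n = fc f n.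
Proof.
move=> sf; rewrite /fourier_coef /fc.
have -> : - cb f n = I01 (fun x => f x * sz (- n) x) by rewrite -cbN.
congr (_ +i* _)%C; rewrite /ca /I01; apply: eq_Rintegral => x _ /=.
  by rewrite mul0r subr0 mulNr mulrN cosN.
by rewrite mul0r addr0 /sz mulrNz.
Qed.

Lemma cabs_fc f n : cabs (fc f n) <= `|ca f n| + `|cb f n|.
Proof. by apply: (le_trans (cabs_le _)); rewrite /= normrN. Qed.

Lemma fc_decay f : smper f ->
  exists2 C : R, 0 <= C & forall n, cabs (fc f n) <= C / `|n|%N.+1%:R.
Proof.
move=> sf; have [C0 c0 h0] := fourier_decay 0 sf; have [C1 c1 h1] := fourier_decay 1 sf.
exists (2 * (C0 + C1)) => [|n]; first by rewrite mulr_ge0// addr_ge0.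
apply: (le_trans (cabs_fc _ _)); rewrite ler_pdivlMr ?ltr0n// -natr1.
have [] := h0 n; have [] := h1 n; rewrite !expr0 !expr1 !mul1r.
by rewrite mulrDr mulr1 [(_ + _) * `|n|%:R]mulrC mulrDr; lra.
Qed.

Lemma ca_cb_mul_trig f n k : smper f ->
  ca (fun x => cz k x * f x) n + cb (fun x => sz k x * f x) n = ca f (n - k) /\
  cb (fun x => cz k x * f x) n - ca (fun x => sz k x * f x) n = cb f (n - k).
Proof.
move=> sf.
have sc h m : smper h -> continuous (fun x => h x * cz m x).
  by move=> sh; exact: (smper_continuous (smperM sh (smper_cz m))).
have ss h m : smper h -> continuous (fun x => h x * sz m x).
  by move=> sh; exact: (smper_continuous (smperM sh (smper_sz m))).
have s1 := smperM (smper_cz k) sf; have s2 := smperM (smper_sz k) sf.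
split.
  rewrite /ca /cb -I01D; [|exact: sc|exact: ss].
  by congr I01; apply/funext => x; rewrite czD czN szN; ring.
rewrite /ca /cb -[X in _ - X]mul1r -mulNr -I01Z; last exact: sc.
rewrite -I01D; [|exact: ss|].
  by congr I01; apply/funext => x; rewrite szD czN szN; ring.
exact: (smper_continuous (smperM (smper_cst _) (smperM s2 (smper_cz n)))).
Qed.

(** The left side is the coefficient of the complex function e^(2 i pi k x) f(x), split into real
    and imaginary parts: the factor shifts the index by k. *)
Lemma fc_mul_trig f n k : smper f ->
  fc (fun x => cz k x * f x) n + ii * fc (fun x => sz k x * f x) n = fc f (n - k).
Proof.
move=> sf; have [h1 h2] := ca_cb_mul_trig n k sf.
by rewrite /fc -h1 -h2; apply/eqP; rewrite eq_complex /=; apply/andP; split; apply/eqP; ring.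
Qed.

Lemma fcD f g n : smper f -> smper g -> fc (fun x => f x + g x) n = fc f n + fc g n.
Proof. by move=> sf sg; rewrite !fcE caD// cbD// !rcD; ring. Qed.

Lemma fcZ c f n : smper f -> fc (fun x => c * f x) n = rc c * fc f n.
Proof. by move=> sf; rewrite !fcE caZ// cbZ// !rcM; ring. Qed.

Lemma fc_cst1 n : fc (fun=> 1) n = (n == 0)%:R.
Proof.
have [->|/(@ca_cb_cst1 R) [h1 h2]] := eqVneq n 0; last by rewrite fcE h1 h2 !rc0 mulr0 subr0.
by have [h1 h2] := @ca_cb_cst0 R; rewrite fcE h1 h2 rc0 rc1 mulr0 subr0.
Qed.

Lemma fc_conj f n : smper f -> (fc f n)^* = fc f (- n).
Proof. by move=> sf; rewrite /fc caN cbN. Qed.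

(** For s = theta this is the phase produced by moving V^n past U. *)
Lemma fc_shift f n s : smper f -> fc (fun x => f (x + s)) n = expi (n%:~R * s) * fc f n.
Proof.
move=> sf; have [h1 h2] := ca_cb_shift n s sf.
by rewrite /fc h1 h2; apply/eqP; rewrite eq_complex /=; apply/andP; split; apply/eqP; rewrite -/(cz n s) -/(sz n s); ring.
Qed.

End FourierCoef.

(** * Real symbols evaluated at a unitary *)

Section Calculus.
Context {R : realType} {A : cstarAlgType R} (V : A) (hV : unitary V).
Implicit Types (f g h : R -> R) (n k : int) (N : nat) (B c : R).

Lemma cnorm_upow n : cnorm (upow V n) = 1.
Proof. exact/cnorm_unitary/unitary_upow. Qed.

Definition psum f N : A := \sum_(n <- zrange N) fc f n *: upow V n.
Definition fcal f : A := fun_of_unitary V (fun x => (f x)%:C)%C.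

Lemma cnorm_fc f n : cnorm (fc f n *: upow V n) <= `|ca f n| + `|cb f n|.
Proof. by rewrite cnormZE cnorm_upow mulr1 cabs_fc. Qed.

(** The 4 counts two opposite indices, each with a cosine and a sine coefficient. *)
Lemma psum_step f f' f'' B : smper f -> smper f' -> smper f'' ->
  deriv f f' -> deriv f' f'' -> (forall x, `|f'' x| <= B) ->
  forall N, cnorm (psum f N.+1 - psum f N) <= 4 * B / N.+1%:R ^+ 2.
Proof.
move=> sf sf' sf'' df df' fB N; rewrite /psum zsumS addrAC subrr add0r.
have [h1 h2] := fourier_decay2 sf sf' sf'' df df' fB N.+1.
rewrite absz_nat in h1 h2.
apply: (le_trans (cnormD_le _ _)).
apply: (le_trans (lerD (cnorm_fc f N.+1) (cnorm_fc f (- N.+1%:Z)))).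
rewrite caN cbN// normrN ler_pdivlMr ?exprn_gt0// mulrC mulrDr mulrDr.
by apply: (le_trans (lerD (lerD h1 h2) (lerD h1 h2))); lra.
Qed.

Lemma fcalP f : smper f -> ncvg (psum f) (fcal f).
Proof.
move=> sf; have [f' df sf'] := smper_deriv sf; have [f'' df' sf''] := smper_deriv sf'.
have [B B0 fB] := smper_bounded sf''.
have [x hx] := ncvg_telescope (mulr_ge0 (ler0n _ 4) (ltW B0)) (psum_step sf sf' sf'' df df' fB).
have E : (fun N => \sum_(n <- zrange N)
    fourier_coef (fun x => (f x)%:C)%C n *: upow V n) = psum f.
  by apply/funext => N; apply: eq_bigr => n _; rewrite fourier_coefE.
(* The limit x found above excludes the default value 0 of [xget]. *)
rewrite /fcal /fun_of_unitary E; case: xgetP => [y -> /norm_cvgP //|].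
by move=> /(_ x); case; apply/norm_cvgP.
Qed.

(** Here 10 = 2 + 8: the term of index 0 costs at most 2B and the others at most twice 4B by
    telescoping. The constant is the same for all f, so approximation errors can be pushed through
    [fcal]. *)
Lemma fcal_bound f f' f'' B : smper f -> smper f' -> smper f'' ->
  deriv f f' -> deriv f' f'' -> (forall x, `|f x| <= B) -> (forall x, `|f'' x| <= B) ->
  cnorm (fcal f) <= 10 * B.
Proof.
move=> sf sf' sf'' df df' fB fB''.
have B0 : 0 <= B := le_trans (normr_ge0 _) (fB 0).
have step := psum_step sf sf' sf'' df df' fB''.
have tel := inv_sqr_telescope cnorm0 (@cnormD_le R A) (mulr_ge0 (ler0n _ 4) B0) step.
rewrite -[fcal f]subr0; apply: (ncvg_bound (fcalP sf)) => N.
rewrite (_ : psum f N - 0 = (psum f N - psum f 0) + psum f 0); last by rewrite subr0 subrK.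
have h0 : cnorm (psum f 0) <= B + B.
  rewrite /psum zsum0; apply: (le_trans (cnorm_fc _ _)).
  by apply: lerD; [exact: ca_le|exact: cb_le].
have := tel N 0%N (leq0n N); rewrite divr1 => h1.
by apply: (le_trans (cnormD_le _ _)); lra.
Qed.

Lemma psumD f g N : smper f -> smper g -> psum (fun x => f x + g x) N = psum f N + psum g N.
Proof.
by move=> sf sg; rewrite /psum -big_split; apply: eq_bigr => n _; rewrite fcD// scalerDl.
Qed.

Lemma psumZ c f N : smper f -> psum (fun x => c * f x) N = rc c *: psum f N.
Proof. by move=> sf; rewrite /psum scaler_sumr; apply: eq_bigr => n _; rewrite fcZ// scalerA. Qed.

Lemma fcalD f g : smper f -> smper g -> fcal (fun x => f x + g x) = fcal f + fcal g.
Proof.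
move=> sf sg; apply: (ncvg_uniq (fcalP (smperD sf sg))).
rewrite (_ : psum _ = fun N => psum f N + psum g N); last by apply/funext => N; exact: psumD.
by apply: ncvgD; exact: fcalP.
Qed.

Lemma fcalZ c f : smper f -> fcal (fun x => c * f x) = rc c *: fcal f.
Proof.
move=> sf; apply: (ncvg_uniq (fcalP (smperM (smper_cst c) sf))).
rewrite (_ : psum _ = fun N => rc c *: psum f N); last by apply/funext => N; exact: psumZ.
by apply: ncvgZ; exact: fcalP.
Qed.

Lemma fcal0 : fcal (fun=> 0) = 0.
Proof.
have := fcalZ 0 (smper_cst 0); rewrite rc0 scale0r => <-.
by congr fcal; apply/funext => x; rewrite mul0r.
Qed.

Lemma fcalN f : smper f -> fcal (fun x => - f x) = - fcal f.
Proof.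
move=> sf; have := fcalZ (-1) sf; rewrite rcN rc1 scaleN1r => <-.
by congr fcal; apply/funext => x; rewrite mulN1r.
Qed.

Lemma fcalB f g : smper f -> smper g -> fcal (fun x => f x - g x) = fcal f - fcal g.
Proof. by move=> sf sg; rewrite fcalD ?fcalN//; exact: smperN. Qed.

Lemma fcal_sum (T : Type) (r : seq T) (F : T -> R -> R) : (forall i, smper (F i)) ->
  fcal (fun x => \sum_(i <- r) F i x) = \sum_(i <- r) fcal (F i).
Proof.
move=> sF; elim: r => [|i r IH]; first by under eq_fun do rewrite big_nil; rewrite big_nil fcal0.
by under eq_fun do rewrite big_cons; rewrite big_cons fcalD ?IH//; exact: smper_sum.
Qed.

Lemma fcal1 : fcal (fun=> 1) = 1.
Proof.
apply: (ncvg_uniq (fcalP (smper_cst 1))).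
rewrite (_ : psum _ = fun=> 1); first exact: ncvg_cst.
apply/funext => N; rewrite /psum (bigD1_seq 0) ?zrange_uniq ?mem_zrange//=; last by apply/andP; split; lia.
rewrite fc_cst1 eqxx scale1r expr0 big1 ?addr0// => n n0.
by rewrite fc_cst1 (negbTE n0) scale0r.
Qed.

Lemma psum_star f N : smper f -> star (psum f N) = psum f N.
Proof.
move=> sf; rewrite /psum star_sum -[RHS]zsum_opp; apply: eq_bigr => n _.
by rewrite starZ fc_conj// star_upow.
Qed.

Lemma fcal_star f : smper f -> star (fcal f) = fcal f.
Proof.
move=> sf; have /ncvg_star := fcalP sf.
rewrite (_ : (fun N => star (psum f N)) = psum f); last by apply/funext => N; exact: psum_star.
by move/ncvg_uniq; apply; exact: fcalP.
Qed.

Lemma zsum_shift (F : int -> A) N :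
  \sum_(n <- zrange N) F (n - 1) - \sum_(n <- zrange N) F n = F (- N.+1%:Z) - F N.
Proof.
elim: N => [|N IH]; first by rewrite !zsum0 sub0r.
have e1 : N.+1%:Z - 1 = N by lia.
have e2 : - N.+1%:Z - 1 = - N.+2%:Z by lia.
have aux (a b c d : A) : (a - b) + ((b + c) - (d + a)) = c - d.
  by rewrite addrA [_ + (b + c)]addrA subrK [a + c]addrC opprD [- d - a]addrC addrA addrK.
by rewrite !zsumS e1 e2 opprD addrACA IH aux.
Qed.

(** The left side is the calculus at e^(2 i pi x) h(x). The coefficients being shifted by one, its
    partial sums differ from V times those of h by two end terms only, which tend to 0. *)
Lemma fcal_mulV h : smper h ->
  fcal (fun x => cz 1 x * h x) + ii *: fcal (fun x => sz 1 x * h x) = V * fcal h.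
Proof.
move=> sh; have s1 := smperM (smper_cz 1) sh; have s2 := smperM (smper_sz 1) sh.
have lim1 := ncvgD (fcalP s1) (ncvgZ ii (fcalP s2)).
apply: (ncvg_uniq lim1).
have [C C0 hC] := fc_decay sh.
apply: (@ncvg_near _ _ (2 * C)) (ncvgMl V (fcalP sh)) => N.
have -> : psum (fun x => cz 1 x * h x) N + ii *: psum (fun x => sz 1 x * h x) N =
    V * \sum_(n <- zrange N) fc h (n - 1) *: upow V (n - 1).
  rewrite /psum scaler_sumr -big_split mulr_sumr; apply: eq_bigr => n _ /=.
  have -> : upow V n = V * upow V (n - 1) by rewrite -upowS// subrK.
  by rewrite scalerA -scalerDl fc_mul_trig// -scalerAr.
rewrite -mulrBr (zsum_shift (fun n => fc h n *: upow V n)).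
apply: (le_trans (cnorm_unitaryM _ hV)).
apply: (le_trans (cnormD_le _ _)); rewrite cnormN !cnormZE !cnorm_upow !mulr1.
have h1 := hC (- N.+1%:Z); have h2 := hC N.
rewrite mulrDl mul1r mulrDl; apply: lerD; last exact: h2.
apply: (le_trans h1); rewrite ler_wpM2l// lef_pV2 ?posrE ?ltr0n// ler_nat.
by rewrite abszN absz_nat.
Qed.

(** Complex multiplication on pairs of algebra elements: the pairs attached to c and s recombine as
    p - t and q + r. A pair is not determined by its combination with [ii], so P and Q are given
    separately. *)
Lemma ii_combine (W c s p q r t P Q : A) : p + ii *: q = W * c -> r + ii *: t = W * s ->
  P = p - t -> Q = q + r -> P + ii *: Q = W * (c + ii *: s).
Proof.
move=> e1 e2 -> ->; rewrite mulrDr -scalerAr -e1 -e2 [in RHS]scalerDr scalerA iiM scaleN1r.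
by rewrite [ii *: r - t]addrC [RHS]addrACA -scalerDr.
Qed.

(** Applying [fcal_mulV] to the two parts of e^(-2 i pi x) h makes the trigonometric factors cancel
    and expresses the image of h as V times the left side; then V is moved across. *)
Lemma fcal_mulVstar h : smper h ->
  fcal (fun x => cz (- 1) x * h x) + ii *: fcal (fun x => sz (- 1) x * h x) = star V * fcal h.
Proof.
move=> sh; have sc := smper_cz (R := R); have ss := smper_sz (R := R).
have s1 := smperM (sc (- 1)) sh; have s2 := smperM (ss (- 1)) sh.
have t1 := smperM (sc 1) s1; have t2 := smperM (ss 1) s1.
have t3 := smperM (sc 1) s2; have t4 := smperM (ss 1) s2.
have e : fcal h + ii *: 0 = V * (fcal (fun x => cz (- 1) x * h x) +
    ii *: fcal (fun x => sz (- 1) x * h x)).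
  apply: (ii_combine (fcal_mulV s1) (fcal_mulV s2)).
    rewrite -(fcalB t1 t4); congr fcal; apply/funext => x.
    by rewrite czN szN -[LHS]mul1r -(cz2Dsz2 1 x); ring.
  rewrite -(fcalD t2 t3) -fcal0; congr fcal; apply/funext => x.
  by rewrite czN szN; ring.
have aux (x y : A) : x + ii *: 0 = V * y -> y = star V * x.
  by rewrite scaler0 addr0 => ->; rewrite mulrA hV.1 mul1r.
exact: aux e.
Qed.

Lemma fcal_trig_step (W : A) (e : int) k g : smper g ->
  (forall h, smper h ->
    fcal (fun x => cz e x * h x) + ii *: fcal (fun x => sz e x * h x) = W * fcal h) ->
  fcal (fun x => cz (k + e) x * g x) + ii *: fcal (fun x => sz (k + e) x * g x) =
  W * (fcal (fun x => cz k x * g x) + ii *: fcal (fun x => sz k x * g x)).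
Proof.
move=> sg hW; have sc := smper_cz (R := R); have ss := smper_sz (R := R).
have s1 := smperM (sc k) sg; have s2 := smperM (ss k) sg.
have t1 := smperM (sc e) s1; have t2 := smperM (ss e) s1.
have t3 := smperM (sc e) s2; have t4 := smperM (ss e) s2.
apply: (ii_combine (hW _ s1) (hW _ s2)).
  by rewrite -(fcalB t1 t4); congr fcal; apply/funext => x; rewrite czD; ring.
by rewrite -(fcalD t2 t3); congr fcal; apply/funext => x; rewrite szD; ring.
Qed.

Lemma fcal_trig k g : smper g ->
  fcal (fun x => cz k x * g x) + ii *: fcal (fun x => sz k x * g x) = upow V k * fcal g.
Proof.
move=> sg; elim/int_rect: k => [|k IH|k IH].
- rewrite mul1r (_ : (fun x => cz 0 x * g x) = g); last by apply/funext => x; rewrite cz0 mul1r.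
  rewrite (_ : (fun x => sz 0 x * g x) = fun=> 0) ?fcal0 ?scaler0 ?addr0//.
  by apply/funext => x; rewrite sz0 mul0r.
- by rewrite -addn1 PoszD (fcal_trig_step _ sg fcal_mulV) IH mulrA upowS.
- by rewrite -addn1 PoszD opprD (fcal_trig_step _ sg fcal_mulVstar) IH mulrA upowP.
Qed.

Lemma cplx_scale (a b : R) (x y : A) : (a -i* b)%C *: (x + ii *: y) =
  (rc a *: x + rc b *: y) + ii *: (rc a *: y - rc b *: x).
Proof.
have e1 : (a -i* b)%C * ii = rc b + ii * rc a.
  by rewrite complexRI rcN mulrDl mulrAC iiM; ring.
rewrite scalerDr scalerA e1 complexRI rcN mulrN scalerBl scalerDl scalerBr !scalerA.
by rewrite -!addrA; congr (_ + _); rewrite addrCA; congr (_ + _); rewrite addrC.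
Qed.

(** Each f_n e^(2 i pi n x) g is handled exactly by [fcal_trig]; the summands carrying [ii] are odd
    in n and cancel. *)
Lemma fcal_fsumM f g N : smper f -> smper g ->
  fcal (fun x => fsum f N x * g x) = psum f N * fcal g.
Proof.
move=> sf sg; have sc := smper_cz (R := R); have ss := smper_sz (R := R).
pose C n := fcal (fun x => cz n x * g x); pose S n := fcal (fun x => sz n x * g x).
have SN n : S (- n) = - S n.
  rewrite -fcalN; last by apply: smperM.
  by congr fcal; apply/funext => x; rewrite szN mulNr.
have CN n : C (- n) = C n by congr fcal; apply/funext => x; rewrite czN.
have S0 : S 0 = 0.
  by rewrite -fcal0; congr fcal; apply/funext => x; rewrite sz0 mul0r.
transitivity (\sum_(n <- zrange N) (rc (ca f n) *: C n + rc (cb f n) *: S n)).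
  rewrite -(_ : (fun x => \sum_(n <- zrange N) (ca f n * (cz n x * g x) + cb f n * (sz n x * g x))) = 
     (fun x => fsum f N x * g x)); last first.
    apply/funext => x; rewrite /fsum mulr_suml; apply: eq_bigr => n _.
    by rewrite /fterm mulrDl !mulrA.
  have k1 n := smperM (sc n) sg; have k2 n := smperM (ss n) sg.
  have m1 n := smperM (smper_cst (ca f n)) (k1 n).
  have m2 n := smperM (smper_cst (cb f n)) (k2 n).
  rewrite (fcal_sum _ (fun n => smperD (m1 n) (m2 n))); apply: eq_bigr => n _.
  by rewrite (fcalD (m1 n) (m2 n)) (fcalZ _ (k1 n)) (fcalZ _ (k2 n)).
rewrite /psum mulr_suml.
under [RHS]eq_bigr do rewrite -scalerAl -fcal_trig// cplx_scale.
have split_ii (P Q : int -> A) : \sum_(n <- zrange N) Q n = 0 ->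
    \sum_(n <- zrange N) (P n + ii *: Q n) = \sum_(n <- zrange N) P n.
  by move=> Q0; rewrite big_split /= -scaler_sumr Q0 scaler0 addr0.
symmetry; apply: (split_ii (fun n => rc (ca f n) *: C n + rc (cb f n) *: S n)
  (fun n => rc (ca f n) *: S n - rc (cb f n) *: C n)); apply: zsum_odd => [|n].
- have := cbN 0 sf; rewrite oppr0 => h; have -> : cb f 0 = 0 by lra.
  by rewrite S0 scaler0 rc0 scale0r subrr.
- by rewrite SN CN caN cbN// rcN scalerN scaleNr opprK opprB addrC.
Qed.

(** Replace f by its partial sums, for which the formula is exact. The error (f_N - f) g and its
    second derivative are O(1/N) uniformly, so [fcal_bound] makes its image tend to 0. *)
Lemma fcalM f g : smper f -> smper g -> fcal (fun x => f x * g x) = fcal f * fcal g.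
Proof.
move=> sf sg.
(* Approximating f'' uniformly uses its own second derivative, hence four derivatives of f. *)
have [f1 df0 s1] := smper_deriv sf; have [f2 df1 s2] := smper_deriv s1.
have [f3 df2 s3] := smper_deriv s2; have [f4 df3 s4] := smper_deriv s3.
have [g1 dg0 t1] := smper_deriv sg; have [g2 dg1 t2] := smper_deriv t1.
have [B2 p2 hB2] := smper_bounded s2; have [B3 p3 hB3] := smper_bounded s3.
have [B4 p4 hB4] := smper_bounded s4.
have [G0 q0 hG0] := smper_bounded sg; have [G1 q1 hG1] := smper_bounded t1.
have [G2 q2 hG2] := smper_bounded t2.
pose K := 8 * (B2 + B3 + B4); pose G := G0 + G1 + G2.
have K0 : 0 <= K by rewrite /K; lra.
have G0' : 0 <= G by rewrite /G; lra.
apply: (ncvg_uniq _ (ncvgMr (fcal g) (fcalP sf))).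
(* The 10 comes from [fcal_bound]; the 4 counts the Leibniz terms in the second derivative of the
   error. *)
apply: (@ncvg_near _ _ (10 * (4 * K * G))) (ncvg_cst _) => N.
rewrite -fcal_fsumM// -fcalB; [|exact: smperM (smper_fsum _ _) _|exact: smperM].
have ap0 y : `|fsum f N y - f y| <= K / N.+1%:R.
  rewrite distrC; apply: (le_trans (fourier_approx sf s1 s2 df0 df1 hB2 N y)).
  by rewrite ler_wpM2r ?invr_ge0// /K; lra.
have ap1 y : `|fsum f1 N y - f1 y| <= K / N.+1%:R.
  rewrite distrC; apply: (le_trans (fourier_approx s1 s2 s3 df1 df2 hB3 N y)).
  by rewrite ler_wpM2r ?invr_ge0// /K; lra.
have ap2 y : `|fsum f2 N y - f2 y| <= K / N.+1%:R.
  rewrite distrC; apply: (le_trans (fourier_approx s2 s3 s4 df2 df3 hB4 N y)).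
  by rewrite ler_wpM2r ?invr_ge0// /K; lra.
pose q := K / N.+1%:R; have q0' : 0 <= q by rewrite divr_ge0.
pose h0 y := fsum f N y - f y; pose h1 y := fsum f1 N y - f1 y.
pose h2 y := fsum f2 N y - f2 y.
have sh0 : smper h0 := smperB (smper_fsum f N) sf.
have sh1 : smper h1 := smperB (smper_fsum f1 N) s1.
have sh2 : smper h2 := smperB (smper_fsum f2 N) s2.
have dB u u' v v' : deriv u u' -> deriv v v' ->
    deriv (fun x : R => u x - v x) (fun x => u' x - v' x).
  by move=> du dv x; exact: (is_deriveB (du x) (dv x)).
have dh0 : deriv h0 h1 := dB _ _ _ _ (deriv_fsum N sf s1 df0) df0.
have dh1 : deriv h1 h2 := dB _ _ _ _ (deriv_fsum N s1 s2 df1) df1.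
have E : (fun x => fsum f N x * g x - f x * g x) = (fun x => h0 x * g x).
  by apply/funext => x; rewrite /h0 mulrBl.
rewrite E.
have -> : 10 * (4 * K * G) / N.+1%:R = 10 * (4 * q * G).
  by rewrite /q; ring.
have d1 := derivM dh0 dg0.
have d2 := derivD (derivM dh0 dg1) (derivM dg0 dh1).
have sd1 := smperD (smperM sh0 t1) (smperM sg sh1).
have sd2 := smperD (smperD (smperM sh0 t2) (smperM t1 sh1)) (smperD (smperM sg sh2) (smperM sh1 t1)).
have bM (u v a b : R) : `|u| <= a -> `|v| <= b -> `|u * v| <= a * b.
  by move=> ua vb; rewrite normrM ler_pM.
have hg0 x : `|g x| <= G by apply: (le_trans (hG0 x)); rewrite /G; lra.
have hg1 x : `|g1 x| <= G by apply: (le_trans (hG1 x)); rewrite /G; lra.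
have hg2 x : `|g2 x| <= G by apply: (le_trans (hG2 x)); rewrite /G; lra.
have qG : 0 <= q * G by rewrite mulr_ge0.
apply: (fcal_bound (smperM sh0 sg) sd1 sd2 d1 d2) => x.
  apply: (le_trans (bM _ _ _ _ (ap0 x) (hg0 x))); rewrite -/q; lra.
apply: (le_trans (ler_normD _ _)).
apply: (le_trans (lerD (ler_normD _ _) (ler_normD _ _))).
have b1 := bM _ _ _ _ (ap0 x) (hg2 x); have b2 := bM _ _ _ _ (hg1 x) (ap1 x).
have b3 := bM _ _ _ _ (hg0 x) (ap2 x); have b4 := bM _ _ _ _ (ap1 x) (hg1 x).
apply: (le_trans (lerD (lerD b1 b2) (lerD b3 b4))); rewrite -/q; lra.
Qed.

End Calculus.

(** * The rotation algebra *)

Section Expi.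
Context {R : realType}.
Implicit Types (x y t : R).

Lemma expiD x y : expi (x + y) = expi x * expi y.
Proof.
rewrite /expi (mulrDr (2 * pi)) cosD sinD; apply/eqP.
by rewrite eq_complex /=; apply/andP; split; apply/eqP; ring.
Qed.

Lemma expi0 : expi (0 : R) = 1.
Proof. by rewrite /expi mulr0 cos0 sin0. Qed.

Lemma cabs_expi x : cabs (expi x) = 1.
Proof. by rewrite /cabs /expi /= cos2Dsin2 sqrtr1. Qed.

(** If the fractional part r were positive, [cz1_lt] with d the distance from r to the nearest
    integer would give cos(2 pi r) <= cos(2 pi d) < 1. *)
Lemma cz1_eq1 t : cz 1 t = 1 -> exists k : int, t = k%:~R.
Proof.
move=> c1; exists (Num.floor t); apply/eqP; rewrite -subr_eq0; apply/negPn/negP => r0.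
have /andP[r0' r1] := frac_itv t; set r := t - _ in r0 r0' r1.
have rp : 0 < r by rewrite lt_neqAle eq_sym r0.
have cr : cz 1 r = 1 by rewrite /r (per_frac t (smper_cz 1).2).
pose d := Num.min r (1 - r).
have d0 : 0 < d by rewrite lt_min rp subr_gt0.
have dr : d <= r by rewrite ge_min lexx.
have dr' : r <= 1 - d by rewrite lerBrDl -lerBrDr ge_min lexx orbT.
have := cz1_lt d0 dr dr'; rewrite cr leNgt => /negP; apply.
have p0 := @pi_gt0 R.
rewrite -(@cos0 R) /cz mul1r ltr_cos ?in_itv/=; first by apply: mulr_gt0; lra.
  by rewrite lexx ltW.
by apply/andP; split; [apply: mulr_ge0; lra|nra].
Qed.

Lemma expi_irrational (theta : R) (m : int) : irrational theta -> m != 0 ->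
  expi (m%:~R * theta) != 1.
Proof.
move=> irr m0; apply/eqP => e; apply: irr.
have [k hk] : exists k : int, m%:~R * theta = k%:~R.
  apply: cz1_eq1; rewrite /cz mul1r.
  by move/(congr1 (@complex.Re R)): e.
have m0' : m%:~R != 0 :> R by rewrite intr_eq0.
exists (k%:Q / m%:Q) => //; rewrite fmorph_div /= !ratr_int -hk mulrAC divff ?mul1r//.
Qed.

End Expi.

(** * Averaging over conjugation by a unitary *)

Section Averaging.
Context {R : realType} {A : cstarAlgType R}.

(* Conjugating by the powers of [W] and averaging kills every [z m] but [z 0]. *)
Lemma averaging_bound (W : A) (s : seq int) (z : int -> A) (lam : int -> R[i]) :
  unitary W -> (forall m, W * z m = lam m *: (z m * W)) ->
  lam 0 = 1 -> (forall m, m != 0 -> lam m != 1) -> (forall m, cabs (lam m) = 1) ->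
  uniq s -> 0 \in s -> cnorm (z 0) <= cnorm (\sum_(m <- s) z m).
Proof.
move=> uW hW lam0 lam1 lamn us s0; set x := \sum_(m <- s) z m.
have uWj j : unitary (W ^+ j).
  by elim: j => [|j IH]; [exact: unitary1|rewrite exprS; exact: unitaryM].
have conjz m j : W ^+ j * z m * star (W ^+ j) = lam m ^+ j *: z m.
  elim: j => [|j IH]; first by rewrite !expr0 mul1r star1 mulr1 scale1r.
  rewrite !exprS starM.
  transitivity (W * (W ^+ j * z m * star (W ^+ j)) * star W); first by rewrite !mulrA.
  by rewrite IH -scalerAr hW scalerA -scalerAl -mulrA uW.2 mulr1 mulrC.
(* Bounds the geometric sum of the powers of [lam m] for any number of terms, so among K conjugates
   only the contribution of [z 0] grows with K. *)
pose b m := 2 / cabs (lam m - 1).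
have b0 m : 0 <= b m by rewrite divr_ge0// cabs_ge0.
have geo m K : m != 0 -> cabs (\sum_(j < K) lam m ^+ j) <= b m.
  move=> /lam1 l1; rewrite ler_pdivlMr; last first.
    rewrite lt_neqAle cabs_ge0 andbT eq_sym; apply: contra l1 => /eqP c0.
    by rewrite -subr_eq0 -normr_eq0 cabsE c0.
  rewrite mulrC -cabsM -subrX1.
  apply: (le_trans (_ : _ <= cabs (lam m ^+ K) + cabs (1 : R[i]))).
    rewrite -lecR /=; move: (ler_normB (lam m ^+ K) 1).
    by rewrite !cabsE -rcD.
  have -> : cabs (lam m ^+ K) = 1.
    by elim: K => [|K IH]; rewrite ?expr0 -?rc1 ?cabs_rc ?normr1// exprS cabsM lamn mul1r.
  by rewrite -rc1 cabs_rc normr1.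
apply: (@ler_natmul_cst _ _ _ (\sum_(m <- s | m != 0) b m * cnorm (z m))) => K.
have E : \sum_(j < K) W ^+ j * x * star (W ^+ j) =
    K%:R *: z 0 + \sum_(m <- s | m != 0) (\sum_(j < K) lam m ^+ j) *: z m.
  transitivity (\sum_(m <- s) (\sum_(j < K) lam m ^+ j) *: z m).
    under eq_bigr do rewrite /x mulr_sumr mulr_suml.
    rewrite exchange_big /=; apply: eq_bigr => m _.
    by rewrite scaler_suml; apply: eq_bigr => j _; rewrite conjz.
  rewrite (bigD1_seq 0)//= lam0; congr (_ *: _ + _).
  by under eq_bigr do rewrite expr1n; rewrite sumr_const card_ord.
have cK : cabs (K%:R : R[i]) = K%:R by rewrite -[K%:R](rmorph_nat (real_complex R)) cabs_rc normr_nat.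
have -> : K%:R * cnorm (z 0) = cnorm ((\sum_(j < K) W ^+ j * x * star (W ^+ j)) -
    \sum_(m <- s | m != 0) (\sum_(j < K) lam m ^+ j) *: z m).
  by rewrite E addrK cnormZE cK.
apply: (le_trans (cnormD_le _ _)); rewrite cnormN; apply: lerD.
  apply: (le_trans (cnorm_sum _ _ _)).
  rewrite mulr_natl -[X in _ *+ X](card_ord K) -sumr_const; apply: ler_sum => j _.
  apply: (le_trans (cnorm_Munitary _ (unitary_star (uWj j)))).
  exact: cnorm_unitaryM.
apply: (le_trans (cnorm_sum _ _ _)); apply: ler_sum => m m0.
by rewrite cnormZE ler_wpM2r ?cnorm_ge0// geo.
Qed.

End Averaging.

(** * Commutation relations, trace and finite symbols in the rotation algebra *)

Section Rotation.
Context {R : realType} {A : cstarAlgType R} (theta : R) (U V : A).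
Hypothesis hrel : rotation_relations theta U V.
Hypothesis irr : irrational theta.
Implicit Types (f g : R -> R) (k m n : int) (N M : nat).

Let hU : unitary U. Proof. by case: hrel. Qed.
Let hV : unitary V. Proof. by case: hrel. Qed.
Let hVU : V * U = expi theta *: (U * V). Proof. by case: hrel. Qed.

Lemma comm_upow (x y : A) (t : R) m : unitary y -> x * y = expi t *: (y * x) ->
  x * upow y m = expi (m%:~R * t) *: (upow y m * x).
Proof.
move=> uy h.
have h' : x * star y = expi (- t) *: (star y * x).
  have e : star y * x = expi t *: (x * star y).
    transitivity (star y * (x * y) * star y); first by rewrite -!mulrA uy.2 mulr1.
    by rewrite h -scalerAr -scalerAl !mulrA uy.1 mul1r.
  by rewrite e scalerA -expiD addNr expi0 scale1r.
elim/int_rect: m => [|m IH|m IH].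
- by rewrite /= mul0r expi0 scale1r expr0 mulr1 mul1r.
- rewrite -addn1 PoszD upowS// mulrA h -scalerAl -[y * x * _]mulrA IH -scalerAr scalerA -expiD mulrA.
  by congr (expi _ *: _); rewrite intrD; ring.
- rewrite -addn1 PoszD opprD upowP// mulrA h' -scalerAl -[star y * x * _]mulrA IH -scalerAr scalerA -expiD mulrA.
  by congr (expi _ *: _); rewrite intrD; ring.
Qed.

Lemma V_upowU m : V * upow U m = expi (m%:~R * theta) *: (upow U m * V).
Proof. exact: comm_upow. Qed.

Lemma U_upowV n : U * upow V n = expi (n%:~R * (- theta)) *: (upow V n * U).
Proof. by apply: comm_upow => //; rewrite hVU scalerA -expiD addNr expi0 scale1r. Qed.

Lemma upowV_U n : upow V n * U = expi (n%:~R * theta) *: (U * upow V n).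
Proof. by rewrite U_upowV scalerA -expiD -mulrDr subrr mulr0 expi0 scale1r. Qed.

Notation fc_ := (fcal V).

(** Moving U to the left of V^n costs the phase e^(2 i pi n theta), which is exactly what
    translating f by theta does to its n-th coefficient. *)
Lemma fcal_commU f : smper f -> fc_ f * U = U * fc_ (fun x => f (x + theta)).
Proof.
move=> sf; have ss := smper_shift theta sf.
have l1 := ncvgMr U (fcalP hV sf); apply: (ncvg_uniq l1).
rewrite (_ : (fun N => psum V f N * U) = fun N => U * psum V (fun x => f (x + theta)) N).
  exact: ncvgMl (fcalP hV ss).
apply/funext => N; rewrite /psum mulr_suml mulr_sumr; apply: eq_bigr => n _.
by rewrite fc_shift// -scalerAl upowV_U scalerA -scalerAr mulrC.
Qed.

Lemma fcal_comm f k : smper f ->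
  fc_ f * upow U k = upow U k * fc_ (fun x => f (x + k%:~R * theta)).
Proof.
have star_comm (x y : A) : y * U = U * x -> x * star U = star U * y.
  by move=> e; rewrite -[x in LHS]mul1r -hU.1 -[star U * U * x]mulrA -e -!mulrA hU.2 mulr1.
have comm_step (x y z a b : A) : x * a = a * y -> y * b = b * z -> x * (a * b) = (a * b) * z.
  by move=> e1 e2; rewrite mulrA e1 -mulrA e2 mulrA.
elim/int_rect: k f => [|k IH|k IH] f sf.
- by rewrite mulr1 mul1r; congr fcal; apply/funext => x; rewrite mul0r addr0.
- rewrite -addn1 PoszD upowS//; apply: etrans (comm_step _ _ _ _ _ (fcal_commU sf) (IH _ (smper_shift _ sf))) _.
  by congr (_ * fcal _ _); apply/funext => x; congr f; rewrite intrD; ring.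
(* For the inverse of U, the relation for the translate of f by -theta is read backwards. *)
- have e := fcal_commU (smper_shift (- theta) sf).
  have e' : (fun x => f (x + theta - theta)) = f by apply/funext => x; rewrite addrK.
  rewrite e' in e.
  have ek : - k.+1%:Z = - k%:Z - 1 by lia.
  have -> : upow U (- k.+1%:Z) = star U * upow U (- k%:Z) by rewrite ek upowP.
  apply: etrans (comm_step _ _ _ _ _ (star_comm _ _ e) (IH _ (smper_shift _ sf))) _.
  by congr (_ * fcal _ _); apply/funext => x; congr f; rewrite ek intrD; ring.
Qed.

(** Two averagings: conjugation by V isolates m = 0, then conjugation by U isolates n = 0. The
    constant 1 does not depend on N, so the bound survives in the limit. *)
Lemma coef00_bound (c : int -> int -> R[i]) N :
  cabs (c 0 0) <= cnorm (\sum_(m <- zrange N) \sum_(n <- zrange N)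
    c m n *: (upow U m * upow V n)).
Proof.
have z0 : 0 \in zrange N by rewrite mem_zrange; apply/andP; split; lia.
have l0 (t : R) : expi (0%:~R * t) = 1 by rewrite mul0r expi0.
have irrN n : n != 0 -> expi (n%:~R * (- theta)) != 1.
  by move=> n0; rewrite mulrN -mulNr -mulrNz expi_irrational ?oppr_eq0.
apply: le_trans (averaging_bound (z := fun m => \sum_(n <- zrange N) c m n *: (upow U m * upow V n))
  (lam := fun m => expi (m%:~R * theta)) hV _ _ _ _ (zrange_uniq N) z0) => //.
- have h : cabs (c 0 0) = cnorm (c 0 0 *: (upow U 0 * upow V 0)).
    by rewrite cnormZE /= !expr0 mulr1 cnorm1 mulr1.
  rewrite h; apply: (averaging_bound (z := fun n => c 0 n *: (upow U 0 * upow V n))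
    (lam := fun n => expi (n%:~R * - theta)) hU) => //; last by exact: zrange_uniq.
    by move=> n; rewrite !mul1r -scalerAr U_upowV -scalerAl !scalerA mulrC.
  by move=> n; exact: cabs_expi.
- move=> m; rewrite mulr_sumr mulr_suml scaler_sumr; apply: eq_bigr => n _.
  rewrite -scalerAr mulrA V_upowU -!scalerAl -!mulrA !scalerA mulrC; congr (_ *: (_ * _)).
  by rewrite -upowS// upowD// upow1.
- by move=> m m0; exact: expi_irrational.
- by move=> m; exact: cabs_expi.
Qed.

(** The difference of two expansions of x has partial sums tending to 0, so [coef00_bound] equates
    their (0, 0) coefficients; whichever expansion [torus_coef] picks, the trace is the same. *)
Lemma torus_traceE (a : int -> int -> R[i]) x : schwartz a -> torus_sum U V a x ->
  torus_trace U V x = a 0 0.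
Proof.
move=> sa ta; rewrite /torus_trace; set a' := torus_coef U V x.
have [_ ta'] : schwartz a' /\ torus_sum U V a' x.
  by rewrite /a' /torus_coef; case: xgetP => [b -> //|/(_ a)]; case.
apply/eqP; rewrite -subr_eq0 -normr_eq0 cabsE; apply/eqP.
suff -> : cabs (a' 0 0 - a 0 0) = 0 by [].
apply/eqP; rewrite eq_le cabs_ge0 andbT; apply/ler_addgt0Pr => e e0; rewrite add0r.
have [N hN] := ncvgD ((norm_cvgP _ _).1 ta') (ncvgZ (-1) ((norm_cvgP _ _).1 ta)) e0.
have := hN N (leqnn N); rewrite !scaleN1r subrr subr0; apply: le_trans.
apply: le_trans (coef00_bound (fun m n => a' m n - a m n) N) _.
rewrite le_eqVlt; apply/orP; left; apply/eqP; congr cnorm; rewrite -sumrB.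
by apply: eq_bigr => m _; rewrite -sumrB; apply: eq_bigr => n _; rewrite scalerBl.
Qed.

Definition symbol_sum M (p_ : int -> R -> R) : A :=
  \sum_(m <- zrange M) upow U m * fc_ (p_ m).

Definition symbol_coef M (p_ : int -> R -> R) : int -> int -> R[i] :=
  fun m n => if (`|m|%N <= M)%N then fc (p_ m) n else 0.

(** Finitely many m occur, so their decay constants in n can be added; for these m the weight 1 +
    |m| + |n| is at most (M + 1)(1 + |n|). *)
Lemma symbol_schwartz M p_ : (forall m, smper (p_ m)) -> schwartz (symbol_coef M p_).
Proof.
move=> sp k.
have one m : exists2 C : R, 0 <= C & forall n, (1 + `|n|)%N%:R ^+ k * cabs (fc (p_ m) n) <= C.
  have [C0 c0 h0] := fourier_decay 0 (sp m); have [C1 c1 h1] := fourier_decay k (sp m).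
  exists (2 ^+ k * (2 * C1) + 2 * C0) => [|n]; first by rewrite addr_ge0// !mulr_ge0// exprn_ge0.
  have [a0 b0] := h0 n; have [a1 b1] := h1 n; rewrite !expr0 !mul1r in a0 b0.
  have hc := cabs_fc (p_ m) n.
  (* At n = 0 a positive power of |n| gives no information and the order 0 bound is used; otherwise
     1 + |n| <= 2|n|. *)
  have [->|n0] := eqVneq n 0.
    rewrite absz0 addn0 expr1n mul1r.
    rewrite -[leLHS]add0r; apply: lerD; first by rewrite !mulr_ge0// exprn_ge0.
    have [a0' b0'] := h0 0; rewrite !expr0 !mul1r in a0' b0'.
    by apply: (le_trans (cabs_fc _ _)); lra.
  rewrite -[leLHS]addr0; apply: lerD; last by rewrite mulr_ge0.
  have n1 : (1 + `|n|)%N%:R <= 2 * `|n|%N%:R :> R.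
    by rewrite -natrM ler_nat; move: n0; lia.
  apply: (@le_trans _ _ ((2 * `|n|%N%:R) ^+ k * (`|ca (p_ m) n| + `|cb (p_ m) n|))).
    by apply: ler_pM; rewrite ?exprn_ge0 ?cabs_ge0// lerXn2r ?nnegrE ?mulr_ge0.
  rewrite exprMn -mulrA ler_wpM2l ?exprn_ge0// mulrDr; lra.
have all_ (s : seq int) : exists2 C : R, 0 <= C & forall m, m \in s ->
    forall n, (1 + `|n|)%N%:R ^+ k * cabs (fc (p_ m) n) <= C.
  elim: s => [|m s [C c0 hC]]; first by exists 0.
  have [C' c0' hC'] := one m; exists (C + C') => [|m']; first exact: addr_ge0.
  rewrite inE => /predU1P[->|ms] n; first by apply: (le_trans (hC' n)); rewrite lerDr.
  by apply: (le_trans (hC _ ms n)); rewrite lerDl.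
have [C c0 hC] := all_ (zrange M).
exists (M.+1%:R ^+ k * C) => m n; rewrite /symbol_coef; case: ifPn => mM; last first.
  by rewrite normr0 mulr0 lecR mulr_ge0// exprn_ge0.
rewrite cabsE -[(1 + _ + _)%N%:R](rmorph_nat (real_complex R)) -rmorphXn -rcM lecR.
have mz : m \in zrange M by rewrite mem_zrange; apply/andP; split; lia.
apply: le_trans (ler_wpM2l _ (hC m mz n)); last by rewrite exprn_ge0.
rewrite mulrA ler_wpM2r ?cabs_ge0// -exprMn lerXn2r ?nnegrE ?mulr_ge0//.
by rewrite -natrM ler_nat; nia.
Qed.

Lemma zsum_trunc (F : int -> A) M N : (M <= N)%N -> (forall m, (M < `|m|)%N -> F m = 0) ->
  \sum_(m <- zrange N) F m = \sum_(m <- zrange M) F m.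
Proof.
move=> MN F0; rewrite -(subnK MN); elim: (N - M)%N => [//|d IH].
by rewrite addSn zsumS IH !F0 ?addr0//; lia.
Qed.

Lemma symbol_torus_sum M p_ : (forall m, smper (p_ m)) ->
  torus_sum U V (symbol_coef M p_) (symbol_sum M p_).
Proof.
move=> sp; apply/norm_cvgP.
have lim (s : seq int) : ncvg (fun N => \sum_(m <- s) upow U m * psum V (p_ m) N)
    (\sum_(m <- s) upow U m * fc_ (p_ m)).
  elim: s => [|m s IH].
    by rewrite big_nil; under eq_fun do rewrite big_nil; exact: ncvg_cst.
  rewrite big_cons; under eq_fun do rewrite big_cons.
  by apply: ncvgD => //; exact: ncvgMl (fcalP hV (sp m)).
move=> e e0; have [N hN] := lim (zrange M) e e0; exists (maxn M N) => L.
rewrite geq_max => /andP[ML /hN h]; rewrite (zsum_trunc ML).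
  rewrite (eq_big_seq (fun m => upow U m * psum V (p_ m) L))// => m.
  rewrite mem_zrange => mM; rewrite /psum mulr_sumr; apply: eq_bigr => n _.
  by rewrite /symbol_coef (_ : (`|m| <= M)%N) ?scalerAr//; lia.
move=> m mM; apply: big1 => n _; rewrite /symbol_coef leqNgt mM /= scale0r//.
Qed.

Lemma smooth_periodic_smper f : smper f -> smooth_periodic (fun x => (f x)%:C)%C.
Proof.
move=> [sf pf]; split=> [x|k x]; first by rewrite pf.
split; first exact: smooth_derivable.
have h : derivable (derive1n k (fun _ : R => 0 : R)) x 1.
  by apply: smooth_derivable; exact: smooth_cst.
exact: h.
Qed.

(** The trace is the (0, 0) coefficient, hence the mean of [p_ 0]. Once it equals t, p itself
    represents the class of t. *)
Lemma symbol_projection M p_ (p : A) (t : R) : (forall m, smper (p_ m)) ->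
  p = symbol_sum M p_ -> projection p -> (exists x, p_ M x != 0) -> I01 (p_ 0) = t ->
  [/\ projection_of_order U V M p, torus_trace U V p = (t%:C)%C & represents_K0 U V t p].
Proof.
move=> sp pE pp [x px] tE.
have ss := symbol_schwartz M sp; have ts := symbol_torus_sum M sp.
have sm : smooth_torus U V p by exists (symbol_coef M p_); rewrite // pE.
have tr : torus_trace U V p = (t%:C)%C.
  rewrite pE (torus_traceE ss ts) /symbol_coef absz0 leq0n fcE /ca /cb -tE.
  under eq_fun do rewrite cz0 mulr1.
  have -> : (fun x => p_ 0 x * sz 0 x) = fun=> 0 by apply/funext => y; rewrite sz0 mulr0.
  by rewrite I01_cst rc0 mulr0 subr0.
split => //.
  split=> //; exists (fun m x => (p_ m x)%:C)%C; split.
  - by move=> m _; exact: smooth_periodic_smper.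
  - by rewrite pE.
  - by exists x; rewrite -[0]/((0 : R)%:C)%C (inj_eq (@complexI R)).
(* With no identity block added, the equivalence of p with itself is x = y = p, because p p = p. *)
exists p; split => //; exists 0%N.
have ent (i j : 'I_(1 + 0)) : smooth_torus U V ((block_mx p%:M 0 0 1%:M : 'M[A]_(1 + 0)) i j).
  have l0 (l : 'I_(1 + 0)) : l = lshift 0 ord0 by apply: val_inj; case: l => [[]].
  by rewrite (l0 i) (l0 j) block_mxEul mxE eqxx mulr1n.
exists (block_mx p%:M 0 0 1%:M), (block_mx p%:M 0 0 1%:M); split=> //.
all: by rewrite mulmx_block !mulmx0 !mul0mx !addr0 !add0r mul1mx -scalar_mxM pp.2.
Qed.

End Rotation.

(** * Bump functions and Rieffel's data *)

Section SmoothStep.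
Context {R : realType}.
Implicit Types (x y t a b c s e : R) (f g : R -> R).

(** The powers of 1/x are included so that derivatives stay in the span of the family. *)
Definition flat (n : nat) x := if 0 < x then x^-1 ^+ n * expR (- x^-1) else 0.

Lemma flat_ge0 n x : 0 <= flat n x.
Proof.
rewrite /flat; case: ifP => // x0.
by rewrite mulr_ge0 ?expR_ge0// exprn_ge0// invr_ge0 ltW.
Qed.

(** The exponential at 1/x exceeds the term of order n + 2 of its series. A quadratic bound is
    enough for a zero derivative at 0. *)
Lemma flat_le n x : flat n x <= (n.+2)`!%:R * x ^+ 2.
Proof.
rewrite /flat; case: ifPn => [x0|_]; last by rewrite mulr_ge0// sqr_ge0.
have y0 : 0 < x^-1 by rewrite invr_gt0.
have f0 : 0 < (n.+2)`!%:R :> R by rewrite ltr0n fact_gt0.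
have h : x^-1 ^+ n.+2 / (n.+2)`!%:R <= expR x^-1.
  by apply: le_trans (expR_ge1Dxn n.+1 (ltW y0)); rewrite lerDr.
rewrite expRN ler_pdivrMr ?expR_gt0//.
rewrite ler_pdivrMr// in h.
have -> : x^-1 ^+ n = x ^+ 2 * x^-1 ^+ n.+2.
  by rewrite -(addn2 n) exprD mulrCA -exprMn divff ?expr1n ?mulr1// gt_eqF.
apply: (@le_trans _ _ (x ^+ 2 * (expR x^-1 * (n.+2)`!%:R))).
  by apply: ler_wpM2l => //; exact: sqr_ge0.
by rewrite mulrA mulrAC [x ^+ 2 * _]mulrC.
Qed.

Lemma is_derive_quadratic f x c : (forall t, `|f (t + x) - f x| <= c * t ^+ 2) ->
  is_derive x 1 f 0.
Proof.
move=> hf.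
have c0 : 0 <= c.
  by have := hf 1; rewrite expr1n mulr1; apply: le_trans; exact: normr_ge0.
have lim : ((fun h => h^-1 *: (f (h *: (1 : R) + x) - f x)) @ 0^' --> (0 : R))%classic.
  apply/cvgrPdist_le => e e0; near=> h.
  rewrite sub0r normrN [h *: _]mulr1 normrM normfV.
  have h0 : h != 0 by near: h; exact: nbhs_dnbhs_neq.
  rewrite ler_pdivrMl ?normr_gt0//; apply: (le_trans (hf h)).
  rewrite -real_normK ?num_real// expr2 mulrA [leRHS]mulrC.
  rewrite ler_wpM2r//.
  have hh : `|h| <= e / (c + 1).
    near: h; apply: nbhs_dnbhs; apply/nbhs_ballP; exists (e / (c + 1)) => /=.
      by rewrite divr_gt0// ltr_wpDl.
    by move=> y; rewrite /ball /= sub0r normrN => /ltW.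
  apply: (@le_trans _ _ ((c + 1) * `|h|)); first by rewrite ler_wpM2r// lerDl.
  by rewrite mulrC -ler_pdivlMr// ltr_wpDl.
apply: DeriveDef; last exact: cvg_lim lim.
by apply/cvg_ex; exists 0.
Unshelve. all: by end_near. Qed.

Lemma deriv_flat n : deriv (flat n) (fun x => flat n.+2 x - n%:R * flat n.+1 x).
Proof.
move=> x; have [x0|x0|->] := ltrgt0P x.
- have xn0 : x != 0 by rewrite gt_eqF.
  apply: (@near_eq_is_derive _ _ _ (fun y => y^-1 ^+ n * expR (- y^-1))).
    near=> y; rewrite /flat ifT//; near: y; exact: lt_nbhsr.
  have dv : is_derive x 1 (fun y : R => y^-1) (- x ^- 2 *: 1).
    by apply: (@is_deriveV _ id x 1 1) => //; exact: is_derive_id.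
  have dn := is_deriveN dv.
  have de := @is_derive1_comp _ expR (fun y : R => - y^-1) x _ _ (is_derive_expR _) dn.
  have dX := is_deriveX n dv.
  have fX (h : R -> R) k : (h ^+ k : R -> R) = fun y => h y ^+ k.
    elim: k => [|k IH]; first by apply/funext => y; rewrite !expr0.
    by apply/funext => y; rewrite !exprS IH.
  rewrite fX in dX.
  have dM := is_deriveM dX de.
  apply: (is_derive_eq dM).
  rewrite /flat x0 /= -!exprVn.
  have sc (y z : R) : y *: z = y * z by [].
  rewrite !sc.
  case: n {dX dM} => [|n] /=; rewrite ?expr0 ?exprS; ring.
- have z k (y : R) : y <= 0 -> flat k y = 0 by move=> y0; rewrite /flat ltNge y0.
  rewrite !z ?(ltW x0)// mulr0 subr0.
  apply: (@near_eq_is_derive _ _ _ (fun=> 0 : R)).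
  near=> y; rewrite z//; apply: ltW; near: y; exact: lt_nbhsl.
- have z k : flat k 0 = 0 by rewrite /flat ltxx.
  rewrite !z mulr0 subr0.
  apply: (@is_derive_quadratic _ _ (n.+2)`!%:R) => t.
  by rewrite addr0 z subr0 ger0_norm ?flat_ge0//; exact: flat_le.
Unshelve. all: by end_near. Qed.

Lemma smooth_flat n : smooth (flat n).
Proof.
move=> k; elim: k n => // k IH n.
exists (fun x => flat n.+2 x - n%:R * flat n.+1 x); split; first exact: deriv_flat.
by apply: CkD => //; apply: CkN; apply: CkM => //; exact: Ck_cst.
Qed.

Lemma flat_gt0 x : 0 < x -> 0 < flat 0 x.
Proof. by move=> x0; rewrite /flat x0 expr0 mul1r expR_gt0. Qed.

Lemma flat0 x : x <= 0 -> flat 0 x = 0.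
Proof. by move=> x0; rewrite /flat ltNge x0. Qed.

(* The projection onto the line spanned by [(flat 0 x, flat 0 (1 - x))] has
   diagonal entries [step x], [1 - step x] and off-diagonal entry [bump x]. *)
Definition denom x := flat 0 x * flat 0 x + flat 0 (1 - x) * flat 0 (1 - x).
Definition step x := flat 0 x * flat 0 x * (denom x)^-1.
Definition bump x := flat 0 x * flat 0 (1 - x) * (denom x)^-1.

Lemma denom_neq0 x : denom x != 0.
Proof.
rewrite gt_eqF// /denom; have [x0|x0] := ltP 0 x.
  by apply: ltr_pwDl; rewrite ?mulr_gt0 ?flat_gt0// mulr_ge0 ?flat_ge0.
by apply: ltr_wpDl; rewrite ?mulr_ge0 ?flat_ge0// mulr_gt0// flat_gt0//; lra.
Qed.

Let smooth_refl : smooth (fun x => flat 0 (1 - x)).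
Proof.
have := smooth_comp (smooth_flat 0) (smooth_lin (-1) 1).
by under [in X in X -> _]eq_fun do rewrite mulN1r addrC.
Qed.

Lemma smooth_denom : smooth (fun x => (denom x)^-1).
Proof.
apply: smoothV denom_neq0 _; apply: smoothD; apply: smoothM => //; exact: smooth_flat.
Qed.

Lemma smooth_step : smooth step.
Proof.
by apply: smoothM smooth_denom; apply: smoothM; exact: smooth_flat.
Qed.

Lemma smooth_bump : smooth bump.
Proof. by apply: smoothM smooth_denom; apply: smoothM => //; exact: smooth_flat. Qed.

Lemma step0 x : x <= 0 -> step x = 0.
Proof. by move=> x0; rewrite /step flat0// !mul0r. Qed.

Lemma step1 x : 1 <= x -> step x = 1.
Proof.
move=> x1; have := denom_neq0 x; rewrite /step /denom (@flat0 (1 - x)); last by lra.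
by rewrite mul0r addr0 => h; rewrite divff.
Qed.

Lemma bump0 x : x <= 0 -> bump x = 0.
Proof. by move=> x0; rewrite /bump flat0// !mul0r. Qed.

Lemma bump1 x : 1 <= x -> bump x = 0.
Proof. by move=> x1; rewrite /bump (@flat0 (1 - x)) ?mulr0 ?mul0r//; lra. Qed.

Lemma bump_sqr x : bump x ^+ 2 = step x * (1 - step x).
Proof.
have := denom_neq0 x; rewrite /bump /step /denom => h.
by field.
Qed.

Lemma bump_half_neq0 : bump (1 / 2) != 0.
Proof.
rewrite /bump mulf_neq0 ?invr_eq0 ?denom_neq0//.
by rewrite mulf_neq0// gt_eqF// flat_gt0//; lra.
Qed.

Lemma antiderivative f c : continuous f -> exists F, forall x, c < x -> is_derive x 1 F (f x).
Proof.
move=> cf; exists (fun x => Rintegral lebesgue_measure `[c, x]%classic f) => x cx.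
have xu : x < x + 1 by rewrite ltrDl.
have [d e] := continuous_FTC1_closed xu (continuous_integrable c (x + 1) cf) cx (cf x).
by apply: (DeriveDef d); rewrite -derive1E; exact: e.
Qed.

(** With F an antiderivative of the step, F(x - a) - F(x - a - s) is an antiderivative of the
    integrand. At x = 1 it is an integral over a window of length s where the step is 1, and at x =
    0 over one where the step is 0. *)
Lemma I01_step_sub a s e : 0 < a -> 0 < e -> 0 < s -> a + s + e < 1 ->
  I01 (fun x => step ((x - a) / e) - step ((x - a - s) / e)) = s.
Proof.
move=> a0 e0 s0 ase.
have sl b : smooth (fun x => step ((x - b) / e)).
  have := smooth_comp smooth_step (smooth_lin e^-1 (- (b / e))).
  by under [in X in X -> _]eq_fun do rewrite mulrC -mulrBl.
pose f x := step ((x - 0) / e).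
have cf : continuous f := smooth_continuous (sl 0).
(* The base point -4 lies to the left of every point at which F is differentiated, as s < 1. *)
have [F dF] := antiderivative (-4) cf.
have mvt x : -2 < x -> x <= 1 -> exists2 y, x - s <= y <= x & F x - F (x - s) = f y * s.
  move=> x2 x1; have xs : x - s <= x by lra.
  have dd y : y \in `]x - s, x[ -> is_derive y 1 F (f y).
    by rewrite in_itv/= => /andP[y1 y2]; apply: dF; lra.
  have [|y] := MVT_segment xs dd.
    apply: derivable_within_continuous => y; rewrite in_itv/= => /andP[y1 y2].
    by have [] : is_derive y 1 F (f y) by apply: dF; lra.
  by rewrite in_itv/= => hy ->; exists y => //; congr (_ * _); lra.
pose G x := F (x - a) - F (x - a - s).
have dG x : 0 <= x <= 1 -> is_derive x 1 G (f (x - a) - f (x - a - s)).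
  move=> /andP[x0 x1].
  have sh b : is_derive x 1 (fun y => y - b) 1 by exact: is_derive_shift.
  have d1 : is_derive (x - a) 1 F (f (x - a)) by apply: dF; lra.
  have d2 : is_derive (x - (a + s)) 1 F (f (x - (a + s))) by apply: dF; lra.
  have e1 := @is_derive1_comp _ F (fun y => y - a) x _ _ d1 (sh a).
  have e2 := @is_derive1_comp _ F (fun y => y - (a + s)) x _ _ d2 (sh (a + s)).
  have -> : G = (F \o (fun y => y - a)) - (F \o (fun y => y - (a + s))).
    by apply/funext => y; rewrite /G -addrA -opprD.
  by apply: (is_derive_eq (is_deriveB e1 e2)); rewrite !mulr1 opprD addrA.
have cfun : continuous (fun x => f (x - a) - f (x - a - s)).
  apply: smooth_continuous; apply: smoothB; first exact: (smooth_shift (- a) (sl 0)).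
  by under eq_fun do rewrite -addrA; exact: (smooth_shift (- a - s) (sl 0)).
have -> : I01 (fun x => step ((x - a) / e) - step ((x - a - s) / e)) = G 1 - G 0.
  rewrite (_ : (fun x => _ - _) = fun x => f (x - a) - f (x - a - s)); last first.
    by apply/funext => x; rewrite /f !subr0.
  rewrite /I01 /Rintegral.
  have derv x : 0 <= x <= 1 -> derivable G x 1 by move=> /dG [].
  have cG x : 0 <= x <= 1 -> {for x, continuous G}.
    by move=> /derv /derivable1_diffP /differentiable_continuous.
  have h0 : 0 <= (0 : R) <= 1 by rewrite lexx ler01.
  have h1 : 0 <= (1 : R) <= 1 by rewrite lexx ler01.
  rewrite (@continuous_FTC2 _ _ G 0 1) ?ltr01//.
  - exact: continuous_subspaceT.
  - split=> [x||].
    + by rewrite in_itv/= => /andP[x0 x1]; apply: derv; rewrite !ltW.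
    + exact: (cvg_at_right_filter (cG _ h0)).
    + exact: (cvg_at_left_filter (cG _ h1)).
  - move=> x; rewrite in_itv/= => /andP[x0 x1]; rewrite derive1E.
    by apply: (@derive_val _ _ _ _ _ _ _ (dG x _)); rewrite !ltW.
have l1 : -2 < 1 - a by lra.
have l2 : 1 - a <= 1 by lra.
have l3 : -2 < 0 - a by lra.
have l4 : 0 - a <= 1 by lra.
rewrite /G; have [y /andP[y1 y2] ->] := mvt _ l1 l2.
have [z /andP[z1 z2] ->] := mvt _ l3 l4.
rewrite /f step1 ?step0; first by rewrite mul1r mul0r subr0.
  by rewrite subr0 pmulr_lle0 ?invr_gt0//; lra.
by rewrite subr0 ler_pdivlMr//; lra.
Unshelve. all: by end_near. Qed.

End SmoothStep.

(** * Periodic extension of functions supported inside (0, 1) *)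

Section Periodize.
Context {R : realType}.
Implicit Types (x y t a b c s e : R) (f g : R -> R).

Definition fracr x := x - (Num.floor x)%:~R.
Definition periodize f x := f (fracr x).
Definition supported f a b := forall x, x < a \/ b < x -> f x = 0.

Lemma fracr_itv x : 0 <= fracr x < 1. Proof. exact: frac_itv. Qed.

Lemma fracrE x y (k : int) : 0 <= y < 1 -> x = y + k%:~R -> fracr x = y.
Proof.
move=> /andP[y0 y1] ->; rewrite /fracr.
have -> : Num.floor (y + k%:~R) = k; last by rewrite addrK.
by apply: floor_def; rewrite intrD; apply/andP; split; lra.
Qed.

Lemma fracr_id x : 0 <= x < 1 -> fracr x = x.
Proof. by move=> h; apply: (fracrE (k := 0)) h _; rewrite addr0. Qed.

Lemma fracrD x t : 0 <= fracr x + t < 1 -> fracr (x + t) = fracr x + t.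
Proof. by move=> h; apply: (fracrE (k := Num.floor x)) h _; rewrite /fracr; ring. Qed.

Lemma fracr1 x : fracr (x + 1) = fracr x.
Proof.
by apply: (fracrE (k := Num.floor x + 1)) (fracr_itv x) _; rewrite /fracr intrD; ring.
Qed.

(** Even across an integer the periodization is locally one fixed translate of f, because f vanishes
    near both ends of the unit interval. *)
Lemma periodize_near f a b x : 0 < a -> b < 1 -> supported f a b ->
  \forall y \near x, f (y - (Num.floor x)%:~R) = periodize f y.
Proof.
move=> a0 b1 sf; set m := Num.floor x.
have /andP[m0 m1] := fracr_itv x; rewrite /fracr -/m in m0 m1.
(* Three margins: y stays below m + 1, and a y below m is sent outside [a, b] by either
   expression. *)
pose d := Num.min (Num.min a (1 - b)) (1 - (x - m%:~R)).
have d0 : 0 < d by rewrite !lt_min a0 !subr_gt0 b1.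
apply/nbhs_ballP; exists d => //= y; rewrite /ball /= !lt_min => /andP[/andP[h1 h2] h3].
have [my|ym] := leP m%:~R y.
  rewrite /periodize (fracrE (y := y - m%:~R) (k := m))//; last by rewrite subrK.
  by move: h3; rewrite distrC ltr_norml => /andP[_ h3]; apply/andP; split; lra.
have xm : x - m%:~R < a /\ x - m%:~R < 1 - b.
  by move: h1 h2; rewrite !ltr_norml => /andP[_ h1] /andP[_ h2]; split; lra.
move: h1 h2 h3; rewrite !ltr_norml => /andP[_ h1] /andP[_ h2] /andP[_ h3].
rewrite sf; last by left; lra.
rewrite /periodize (fracrE (y := y - m%:~R + 1) (k := m - 1)).
- by rewrite sf//; right; lra.
- by apply/andP; split; lra.
- by rewrite intrD; ring.
Qed.

Lemma deriv_supported f f' a b : deriv f f' -> supported f a b -> supported f' a b.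
Proof.
move=> df sf x hx; have := df x.
have d0 : is_derive x 1 f 0.
  apply: (@near_eq_is_derive _ _ _ (fun=> 0 : R)).
  case: hx => hx; near=> y; rewrite sf//.
    by left; near: y; exact: lt_nbhsl.
  by right; near: y; exact: lt_nbhsr.
by case=> _ <-; case: d0.
Unshelve. all: by end_near. Qed.

Lemma smper_periodize f a b : 0 < a -> b < 1 -> smooth f -> supported f a b ->
  smper (periodize f).
Proof.
move=> a0 b1 sf hf; split=> [k|x]; last by rewrite /periodize fracr1.
elim: k f sf hf => // k IH f sf hf.
have [f' df sf'] := smooth_deriv sf; have hf' := deriv_supported df hf.
exists (periodize f'); split; last exact: IH.
move=> x; have d := deriv_shift (- (Num.floor x)%:~R) df x.
rewrite -(nbhs_singleton (periodize_near x a0 b1 hf')).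
exact: near_eq_is_derive (periodize_near x a0 b1 hf) d.
Qed.

Lemma I01_periodize f a b : 0 < a -> b < 1 -> supported f a b -> I01 (periodize f) = I01 f.
Proof.
move=> a0 b1 sf; rewrite /I01; apply: eq_Rintegral => x.
rewrite inE /= in_itv /= => /andP[x0]; rewrite le_eqVlt => /predU1P[->|x1].
  rewrite /periodize (fracrE (y := 0) (k := 1)) ?add0r ?lexx ?ltr01//.
  by rewrite !sf//; [right|left].
by rewrite /periodize fracr_id// x0.
Qed.

End Periodize.

(** * Pairs of functions defining Rieffel projections *)

Section RieffelData.
Context {R : realType}.
Implicit Types (x y t a b c s e : R) (f g : R -> R).

(* The symbols for which [f(V) + U^k g(V) + g(V) U^-k], with [s = k theta], is
   a projection. *)
Definition rieffel s f g :=
  [/\ smper f, smper g, forall x, g x * g (x + s) = 0,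
      forall x, g x * (f x + f (x + s)) = g x &
      forall x, f x * f x + g x * g x + g (x - s) * g (x - s) = f x].

(** The third function is the coefficient of U^-k once that power is moved to the left of g(V). *)
Definition vanishes s f g x := [/\ f x = 0, g x = 0 & g (x - s) = 0].

Definition rieffel_in s f g a b := forall x, fracr x <= a \/ b <= fracr x -> vanishes s f g x.

(** f rises from 0 to 1 on [a, a + e] and falls on the translate of this interval by s, following
    the translated profile; g is the bump over the rise. Hence f x + f (x + s) = 1 wherever g x is
    nonzero. The condition e <= s puts the rise before the fall. *)
Lemma rieffel_basic a s e : 0 < a -> 0 < e -> e <= s -> a + s + e < 1 ->
  exists f g, [/\ rieffel s f g, rieffel_in s f g a (a + s + e), I01 f = s,
    forall x, a + e <= fracr x <= a + s -> [/\ f x = 1, g x = 0 & g (x - s) = 0] &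
    exists2 x, a < fracr x < a + s + e & g x != 0].
Proof.
move=> a0 e0 es ase.
pose p x := step ((x - a) / e); pose q x := step ((x - a - s) / e).
pose f x := p x - q x; pose g x := bump ((x - a) / e).
have sl b h : smooth h -> smooth (fun x => h ((x - b) / e)).
  move=> sh; have := smooth_comp sh (smooth_lin e^-1 (- (b / e))).
  by under [in X in X -> _]eq_fun do rewrite mulrC -mulrBl.
have p0 x : x <= a -> p x = 0.
  by move=> h; rewrite /p step0// pmulr_lle0 ?invr_gt0//; lra.
have p1 x : a + e <= x -> p x = 1.
  by move=> h; rewrite /p step1// ler_pdivlMr//; lra.
have q0 x : x <= a + s -> q x = 0.
  by move=> h; rewrite /q step0// pmulr_lle0 ?invr_gt0//; lra.
have q1 x : a + s + e <= x -> q x = 1.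
  by move=> h; rewrite /q step1// ler_pdivlMr//; lra.
have g0 x : x <= a -> g x = 0.
  by move=> h; rewrite /g bump0// pmulr_lle0 ?invr_gt0//; lra.
have g1 x : a + e <= x -> g x = 0.
  by move=> h; rewrite /g bump1// ler_pdivlMr//; lra.
have pq x : q (x + s) = p x by rewrite /q /p; congr step; congr (_ / _); ring.
have gg x : g x * g x = p x * (1 - p x) by rewrite -expr2 /g bump_sqr.
have sf : supported f a (a + s + e).
  move=> x [h|h]; rewrite /f; first by rewrite p0 ?q0 ?subrr//; lra.
  by rewrite p1 ?q1 ?subrr//; lra.
have sg : supported g a (a + s + e).
  by move=> x [h|h]; [rewrite g0//; lra|rewrite g1//; lra].
have smf : smooth f.
  apply: smoothB; first exact: sl smooth_step.
  rewrite /q; under eq_fun do rewrite -addrA -opprD; exact: sl smooth_step.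
have smg : smooth g := sl a _ smooth_bump.
exists (periodize f), (periodize g).
(* If x - s wraps around, it lands beyond a + e while the unwrapped point is negative, and g
   vanishes at both. *)
have Gm x : periodize g (x - s) = g (fracr x - s).
  have /andP[u0 u1] := fracr_itv x; have [h|h] := leP s (fracr x).
    by rewrite /periodize fracrD//; apply/andP; split; lra.
  rewrite /periodize (fracrE (y := fracr x - s + 1) (k := Num.floor x - 1)).
  - by rewrite g1; [rewrite g0//; lra|lra].
  - by apply/andP; split; lra.
  - by rewrite intrD /fracr; ring.
have Gx x : g (fracr x) = 0 \/ a < fracr x < a + e.
  have [h|h] := leP (fracr x) a; first by left; exact: g0.
  have [h'|h'] := leP (a + e) (fracr x); first by left; exact: g1.
  by right.
have fx x : a < fracr x < a + e -> fracr (x + s) = fracr x + s.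
  by move=> /andP[h1 h2]; apply: fracrD; apply/andP; split; lra.
split.
- split; [exact: smper_periodize a0 ase smf sf|exact: smper_periodize a0 ase smg sg| | |].
  + move=> x; rewrite /periodize; have [->|h] := Gx x; first by rewrite mul0r.
    by move/andP: (h) => [h1 h2]; rewrite (fx _ h) (g1 (_ + s)) ?mulr0//; lra.
  + move=> x; rewrite /periodize; have [->|h] := Gx x; first by rewrite mul0r.
    move/andP: (h) => [h1 h2]; rewrite (fx _ h) /f pq (p1 (_ + s)); last by lra.
    by rewrite q0; [ring|lra].
  + move=> x; rewrite Gm /periodize !gg -[p (fracr x - s)]pq subrK /f.
    have [h|h] := leP (fracr x) (a + s); first by rewrite (q0 _ h); ring.
    by rewrite p1; [ring|lra].
- move=> x h; rewrite /vanishes Gm /periodize /f; case: h => h; split.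
  + by rewrite p0 ?q0 ?subrr//; lra.
  + by rewrite g0.
  + by rewrite g0//; lra.
  + by rewrite p1 ?q1 ?subrr//; lra.
  + by rewrite g1//; lra.
  + by rewrite g1//; lra.
- by rewrite (I01_periodize a0 ase sf); apply: I01_step_sub => //; lra.
- move=> x /andP[h1 h2]; rewrite Gm /periodize /f; split.
  + by rewrite p1 ?q0 ?subr0.
  + by rewrite g1.
  + by rewrite g0//; lra.
- exists (a + e / 2); rewrite /periodize ?fracr_id; try by apply/andP; split; lra.
  rewrite /g (_ : (a + e / 2 - a) / e = 1 / 2) ?bump_half_neq0//.
  by field; rewrite gt_eqF.
Qed.

(** At every point one of the two pairs vanishes, which removes all cross terms. *)
Lemma rieffel_add s f1 g1 f2 g2 a b c : b <= c -> a <= b ->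
  rieffel s f1 g1 -> rieffel s f2 g2 -> rieffel_in s f1 g1 a b -> rieffel_in s f2 g2 b c ->
  rieffel s (fun x => f1 x + f2 x) (fun x => g1 x + g2 x) /\
  rieffel_in s (fun x => f1 x + f2 x) (fun x => g1 x + g2 x) a c.
Proof.
move=> bc ab [sf1 sg1 r1 r2 r3] [sf2 sg2 t1 t2 t3] v1 v2; split; last first.
  move=> x h; rewrite /vanishes; have [|-> -> ->] := v1 x.
    by case: h => h; [left|right; lra].
  by have [|-> -> ->] := v2 x; rewrite ?addr0//; case: h => h; [left; lra|right].
have v x : vanishes s f1 g1 x \/ vanishes s f2 g2 x.
  by have [h|h] := leP (fracr x) b; [right; apply: v2; left|left; apply: v1; right; exact: ltW].
(* Vanishing at x + s includes g at (x + s) - s, so the pair that is zero at x + s also has g x =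
   0. *)
have vs x : [/\ f1 (x + s) = 0, g1 (x + s) = 0 & g1 x = 0] \/
            [/\ f2 (x + s) = 0, g2 (x + s) = 0 & g2 x = 0].
  by case: (v (x + s)) => -[e0 e1 e2]; [left|right]; split=> //; rewrite -e2 addrK.
split; [exact: smperD|exact: smperD| | |] => x.
- by case: (vs x) => -[_ -> ->]; rewrite ?addr0 ?add0r.
- case: (vs x) => -[-> _ g0]; rewrite g0 ?addr0 ?add0r.
    case: (v x) => -[f0 g0' _]; first by rewrite f0 !add0r.
    by rewrite g0' mul0r.
  case: (v x) => -[f0 g0' _]; last by rewrite f0 !addr0.
  by rewrite g0' mul0r.
- by case: (v x) => -[-> -> ->]; rewrite ?addr0 ?add0r.
Qed.

(** Blocks of integral s are placed side by side, each new one taking half of the remaining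
    slack. *)
Lemma rieffel_multi s (r : nat) a b : 0 < s -> 0 <= a -> a + r%:R * s < b -> b <= 1 ->
  exists f g, [/\ rieffel s f g, rieffel_in s f g a b & I01 f = r%:R * s].
Proof.
move=> s0 a0; elim: r b => [|r IH] b.
  rewrite mul0r addr0 => ab b1; exists (fun=> 0), (fun=> 0); split.
  - by split; [exact: smper_cst|exact: smper_cst|move=> x; ring|move=> x; ring|move=> x; ring].
  - by [].
  - exact: I01_cst.
rewrite -natr1 mulrDl mul1r => hb b1.
pose d := (b - (a + (r%:R * s + s))) / 2; have d0 : 0 < d by rewrite /d; lra.
pose m := a + r%:R * s + d.
have rs : 0 <= r%:R * s by rewrite mulr_ge0// ltW.
have hm : a + r%:R * s < m by rewrite /m; lra.
have bE : b = m + d + s by rewrite /m /d; lra.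
have mb : m <= b by lra.
have am : a <= m by lra.
have [||f1 [g1 [h1 v1 i1]]] := IH m => //; first by lra.
(* The new block occupies [m + e, m + 2e + s], inside [m, b] because b = m + d + s; [rieffel_basic]
   also asks for e <= s. *)
pose e := Num.min (d / 3) s.
have e0 : 0 < e by rewrite lt_min s0 andbT; lra.
have es : e <= s by rewrite ge_min lexx orbT.
have ed : e <= d / 3 by rewrite ge_min lexx.
have me0 : 0 < m + e by lra.
have mes : m + e + s + e < 1 by lra.
have [f2 [g2 [h2 v2 i2 _ _]]] := rieffel_basic me0 e0 es mes.
have v2' : rieffel_in s f2 g2 m b.
  by move=> x hx; apply: v2; case: hx => hx; [left|right]; lra.
have [h v] := rieffel_add mb am h1 h2 v1 v2'.
exists (fun x => f1 x + f2 x), (fun x => g1 x + g2 x); split=> //.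
case: h1 => s1 _ _ _ _; case: h2 => s2 _ _ _ _.
by rewrite I01D ?i1 ?i2//; exact: smper_continuous.
Qed.

End RieffelData.

(** * Rieffel projections *)

Section RieffelProjection.
Context {R : realType} {A : cstarAlgType R} (theta : R) (U V : A).
Hypothesis hrel : rotation_relations theta U V.
Implicit Types (f g h : R -> R) (k m n j : int) (N M : nat).

Let hU : unitary U. Proof. by case: hrel. Qed.
Let hV : unitary V. Proof. by case: hrel. Qed.
Notation fc_ := (fcal V).

Definition rief k f g : A := fc_ f + upow U k * fc_ g + fc_ g * upow U (- k).

Lemma rief_star k f g : smper f -> smper g -> star (rief k f g) = rief k f g.
Proof.
move=> sf sg; have sF := fcal_star hV sf; have sG := fcal_star hV sg.
have aux (F G W W' : A) : star F = F -> star G = G -> star W = W' -> star W' = W ->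
    star (F + W * G + G * W') = F + W * G + G * W'.
  by move=> eF eG eW eW'; rewrite !starD !starM eF eG eW eW' addrAC.
by apply: aux => //; rewrite star_upow// opprK.
Qed.

Lemma fcal_commN k f : smper f ->
  fc_ f * upow U (- k) = upow U (- k) * fc_ (fun x => f (x - k%:~R * theta)).
Proof.
move=> sf; apply: etrans (fcal_comm hrel (- k) sf) _.
by congr (_ * fcal _ _); apply/funext => x; rewrite mulrNz mulNr.
Qed.

(** The hypotheses are the parts of the equation of degrees k, 2k and 0 in U; those of negative
    degree follow by taking adjoints. *)
Lemma selfadjoint_idem (F X : A) : star F = F -> F * X + X * F = X -> X * X = 0 ->
  F * F + X * star X + star X * X = F ->
  (F + X + star X) * (F + X + star X) = F + X + star X.
Proof.
move=> sF e1 e2 e3.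
have e1' : F * star X + star X * F = star X.
  by rewrite -[RHS](congr1 (@star R A) e1) starD !starM sF addrC.
have e2' : star X * star X = 0 by rewrite -starM e2 star0.
rewrite !mulrDl !mulrDr e2 e2' addr0.
have ac (a1 a2 a3 b1 b2 c1 c2 : A) : a1 + a2 + a3 + (b1 + b2) + (c1 + c2) =
    (a1 + b2 + c2) + (a2 + b1) + (a3 + c1).
  by rewrite [LHS](AC (3*2*2) ((1*5*7)*(2*4)*(3*6)))%AC.
by rewrite addr0 ac e3 e1 e1'.
Qed.

(** Fp and Gp stand for the translates of f and g by s, GG for g^2 and Gm for its translate by
    -s. *)
Lemma rief_idem_aux (F G Fp Gp GG Gm W W' : A) :
  star F = F -> star G = G -> star W = W' ->
  W * W' = 1 -> W' * W = 1 -> F * W = W * Fp -> G * W = W * Gp -> GG * W' = W' * Gm ->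
  Fp * G + G * F = G -> Gp * G = 0 -> G * G = GG -> F * F + Gm + GG = F ->
  (F + W * G + G * W') * (F + W * G + G * W') = F + W * G + G * W'.
Proof.
move=> sF sG sW WW' W'W FW GW GGW' r2 r1 gg r3.
have sX : star (W * G) = G * W' by rewrite starM sG sW.
rewrite -sX; apply: selfadjoint_idem => //; rewrite ?sX.
- by rewrite mulrA FW -mulrA -(mulrA W) -mulrDr r2.
- by rewrite mulrA -(mulrA W) GW -!mulrA r1 !mulr0.
- rewrite [W * G * _]mulrA -(mulrA W) gg -mulrA GGW' mulrA WW' mul1r.
  by rewrite [G * W' * _]mulrA -(mulrA G) W'W mulr1 gg.
Qed.

Lemma rief_idem k f g : rieffel (k%:~R * theta) f g -> rief k f g * rief k f g = rief k f g.
Proof.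
move=> [sf sg r1 r2 r3].
have sgg := smperM sg sg; have sfp := smper_shift (k%:~R * theta) sf.
have sgp := smper_shift (k%:~R * theta) sg; have sgm := smper_shift (- (k%:~R * theta)) sg.
have sgmm := smperM sgm sgm.
apply: (rief_idem_aux (fcal_star hV sf) (fcal_star hV sg) (star_upow k hU) _ _
  (fcal_comm hrel k sf) (fcal_comm hrel k sg) (fcal_commN k sgg)).
- by rewrite -upowD// subrr.
- by rewrite -upowD// addNr.
- apply: etrans (congr2 +%R (esym (fcalM hV sfp sg)) (esym (fcalM hV sg sf))) _.
  apply: etrans (esym (fcalD hV (smperM sfp sg) (smperM sg sf))) _.
  by congr fcal; apply/funext => x; rewrite -[RHS]r2; ring.
- apply: etrans (esym (fcalM hV sgp sg)) (etrans _ (fcal0 hV)).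
  by congr fcal; apply/funext => x; rewrite mulrC r1.
- exact: esym (fcalM hV sg sg).
- have sff := smperM sf sf.
  have e1 := esym (fcalM hV sf sf).
  have e2 := esym (fcalD hV sff sgmm).
  have e3 := esym (fcalD hV (smperD sff sgmm) sgg).
  apply: etrans (congr1 (fun z => z + _ + _) e1) (etrans (congr1 (fun z => z + _) e2) (etrans e3 _)).
  by congr fcal; apply/funext => x; rewrite -[RHS]r3 addrAC.
Qed.

(** The first projection acts as the scalar c on the support of the second: c = 0 for disjoint
    supports, c = 1 on the plateau. *)
Definition acts_on c s f g s' f' g' := forall x : R, vanishes s' f' g' x \/
  [/\ f x = c, g x = 0 & g (x - s) = 0].

(** The second factor is a sum of products of a function of V by a power of U, function first, and
    the first factor multiplies each such function by c. *)
Lemma rief_absorb c k f g k' f' g' : smper f -> smper g -> smper f' -> smper g' ->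
  acts_on c (k%:~R * theta) f g (k'%:~R * theta) f' g' ->
  rief k f g * rief k' f' g' = rc c *: rief k' f' g'.
Proof.
set s := k%:~R * theta; set s' := k'%:~R * theta.
move=> sf sg sf' sg' act.
have sgm := smper_shift (- s) sg; have sgm' := smper_shift (- s') sg'.
have absorb y : smper y -> (forall x, vanishes s' f' g' x -> y x = 0) ->
    rief k f g * fc_ y = rc c *: fc_ y.
  move=> sy hy.
  have aux (F G Gm W W' Y cY : A) : G * W' = W' * Gm -> F * Y = cY -> G * Y = 0 -> Gm * Y = 0 ->
      (F + W * G + G * W') * Y = cY.
    by move=> e1 e2 e3 e4; rewrite !mulrDl e1 e2 -!mulrA e3 e4 !mulr0 !addr0.
  apply: (aux _ _ _ _ _ _ _ (fcal_commN k sg)).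
  - apply: etrans (esym (fcalM hV sf sy)) (etrans _ (fcalZ hV c sy)); congr fcal.
    by apply/funext => x; case: (act x) => [/hy ->|[-> _ _]]; rewrite ?mulr0.
  - apply: etrans (esym (fcalM hV sg sy)) (etrans _ (fcal0 hV)); congr fcal.
    by apply/funext => x; case: (act x) => [/hy ->|[_ -> _]]; rewrite ?mulr0 ?mul0r.
  - apply: etrans (esym (fcalM hV sgm sy)) (etrans _ (fcal0 hV)); congr fcal.
    by apply/funext => x; case: (act x) => [/hy ->|[_ _ ->]]; rewrite ?mulr0 ?mul0r.
have a1 : rief k f g * fc_ f' = rc c *: fc_ f' by apply: absorb => // x [].
have a2 : rief k f g * fc_ g' = rc c *: fc_ g' by apply: absorb => // x [].
have a3 : rief k f g * fc_ (fun x => g' (x - s')) = rc c *: fc_ (fun x => g' (x - s')).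
  by apply: absorb => // x [].
(* Moving U^k' to the right makes the translate of g' the leading factor, where [absorb] applies. *)
have a4 : fc_ (fun x => g' (x - s')) * upow U k' = upow U k' * fc_ g'.
  apply: etrans (fcal_comm hrel k' sgm') _; congr (_ * fcal _ _).
  by apply/funext => x; rewrite addrK.
have aux (P F G Gm W W' : A) : P * F = rc c *: F -> P * G = rc c *: G -> P * Gm = rc c *: Gm ->
    Gm * W = W * G -> P * (F + W * G + G * W') = rc c *: (F + W * G + G * W').
  by move=> e1 e2 e3 e4; rewrite -e4 !mulrDr !mulrA e1 e2 e3 -!scalerAl -!scalerDr.
exact: aux a1 a2 a3 a4.
Qed.

Definition monosym j h m x := (m == j)%:R * h x.
Definition rsym k f g m x :=
  monosym 0 f m x + monosym k g m x + monosym (- k) (fun y => g (y - k%:~R * theta)) m x.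

Lemma smper_monosym j h m : smper h -> smper (monosym j h m).
Proof. by move=> sh; apply: smperM sh; exact: smper_cst. Qed.

Lemma smper_rsym k f g m : smper f -> smper g -> smper (rsym k f g m).
Proof.
move=> sf sg; apply: smperD; first by apply: smperD; exact: smper_monosym.
by apply: smper_monosym; exact: smper_shift.
Qed.

Lemma symbol_sumD M p q : (forall m, smper (p m)) -> (forall m, smper (q m)) ->
  symbol_sum U V M (fun m x => p m x + q m x) = symbol_sum U V M p + symbol_sum U V M q.
Proof.
move=> sp sq; rewrite /symbol_sum -big_split; apply: eq_bigr => m _ /=.
by rewrite (fcalD hV (sp m) (sq m)) mulrDr.
Qed.

Lemma symbol_sumZ M c p : (forall m, smper (p m)) ->
  symbol_sum U V M (fun m x => c * p m x) = rc c *: symbol_sum U V M p.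
Proof.
move=> sp; rewrite /symbol_sum scaler_sumr; apply: eq_bigr => m _ /=.
by rewrite (fcalZ hV c (sp m)) -scalerAr.
Qed.

Lemma symbol_sum_mono M j h : smper h -> j \in zrange M ->
  symbol_sum U V M (monosym j h) = upow U j * fc_ h.
Proof.
move=> sh jM; rewrite /symbol_sum (bigD1_seq j) ?zrange_uniq//= big1 ?addr0.
  by congr (_ * fcal _ _); apply/funext => x; rewrite /monosym eqxx mul1r.
move=> m /negbTE mj.
rewrite (_ : monosym j h m = fun=> 0) ?fcal0 ?mulr0//.
by apply/funext => x; rewrite /monosym mj mul0r.
Qed.

Lemma symbol_sum_rsym M k f g : smper f -> smper g -> (`|k| <= M)%N ->
  symbol_sum U V M (rsym k f g) = rief k f g.
Proof.
move=> sf sg kM; have sg' := smper_shift (- (k%:~R * theta)) sg.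
rewrite /rief (fcal_commN k sg) /rsym symbol_sumD; first last.
- by move=> m; exact: smper_monosym.
- by move=> m; apply: smperD; exact: smper_monosym.
rewrite symbol_sumD; [|by move=> m; exact: smper_monosym|by move=> m; exact: smper_monosym].
rewrite !symbol_sum_mono ?mem_zrange//; try by apply/andP; split; lia.
by rewrite mul1r.
Qed.

(** Either p and q are orthogonal and are added, or q lies below p and is subtracted. *)
Lemma projectionP (p q : A) (e c : R) : star p = p -> p * p = p -> star q = q -> q * q = q ->
  p * q = rc c *: q -> (e = 1 /\ c = 0) \/ (e = -1 /\ c = 1) -> projection (p + rc e *: q).
Proof.
move=> sp pp sq qq pq H.
have rcconj (r : R) : (rc r)^* = rc r by rewrite -[LHS]/((r -i* 0)%C) oppr0.
have qp : q * p = rc c *: q.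
  by rewrite -[LHS]starK starM sp sq pq starZ rcconj sq.
split; first by rewrite starD starZ rcconj sp sq.
rewrite mulrDl !mulrDr -!scalerAl -!scalerAr qp pp qq pq.
case: H => -[-> ->]; rewrite ?rcN ?rc1 ?rc0 ?scaleN1r ?scale1r ?scale0r ?addr0 ?add0r//.
by rewrite opprK addNr addr0.
Qed.

End RieffelProjection.

(** * Placing the blocks on the circle *)

Section RieffelChoice.
Context {R : realType}.

Lemma rieffel_choice (theta : R) (M n : nat) : (1 <= M)%N -> (1 <= n)%N ->
  0 < theta < (maxn n M)%:R^-1 ->
  exists (f1 g1 f2 g2 : R -> R) (e c : R), [/\ rieffel (M%:R * theta) f1 g1, rieffel theta f2 g2,
    acts_on c (M%:R * theta) f1 g1 theta f2 g2,
    (e = 1 /\ c = 0) \/ (e = -1 /\ c = 1) &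
    I01 f1 + e * I01 f2 = n%:R * theta /\ exists x, g1 x != 0].
Proof.
move=> M1 n1 /andP[t0 tm].
have mx : 0 < (maxn n M)%:R :> R by rewrite ltr0n leq_max n1.
have mt : (maxn n M)%:R * theta < 1 by rewrite mulrC -ltr_pdivlMr// mul1r.
have nt : n%:R * theta < 1.
  by apply: le_lt_trans mt; rewrite ler_wpM2r ?(ltW t0)// ler_nat leq_maxl.
have Mt : M%:R * theta < 1.
  by apply: le_lt_trans mt; rewrite ler_wpM2r ?(ltW t0)// ler_nat leq_maxr.
have s0 : 0 < M%:R * theta by rewrite mulr_gt0// ltr0n.
have n0 : 0 < n%:R * theta by rewrite mulr_gt0// ltr0n.
set s := M%:R * theta in Mt s0 *.
have [Mn|nM] := leqP M n.
- have rE : n%:R * theta = s + (n - M)%:R * theta by rewrite /s natrB//; ring.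
  (* The slack 1 - n theta is 4d: d is left before the first block, e <= d goes to its ramp, and at
     least 2d remains for the other blocks. *)
  pose d := (1 - n%:R * theta) / 4.
  have d0 : 0 < d by rewrite /d; lra.
  have dE : n%:R * theta = 1 - 4 * d by rewrite /d; lra.
  have r0 : 0 <= (n - M)%:R * theta by rewrite mulr_ge0// ltW.
  pose e := Num.min d s.
  have e0 : 0 < e by rewrite lt_min d0.
  have es : e <= s by rewrite ge_min lexx orbT.
  have ed : e <= d by rewrite ge_min lexx.
  have dse : d + s + e < 1 by lra.
  have [f1 [g1 [h1 v1 i1 _ [x _ gx]]]] := rieffel_basic d0 e0 es dse.
  have a0 : 0 <= d + s + e by lra.
  have ar : d + s + e + (n - M)%:R * theta < 1 by lra.
  have [f2 [g2 [h2 v2 i2]]] := rieffel_multi t0 a0 ar (lexx 1).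
  exists f1, g1, f2, g2, 1, 0; split=> //; [|by left|by split; [rewrite i1 i2 mul1r rE|exists x]].
  move=> y; have [h|h] := leP (fracr y) (d + s + e).
    by left; apply: v2; left.
  by right; have [-> -> ->] := v1 y (or_intror (ltW h)).
have rE : s = n%:R * theta + (M - n)%:R * theta by rewrite /s natrB ?(ltnW nM)//; ring.
(* One third of the slack precedes the block and e <= d extends it on the right, so it still ends
   before 1. *)
pose d := (1 - s) / 3.
have d0 : 0 < d by rewrite /d; lra.
have dE : s = 1 - 3 * d by rewrite /d; lra.
have r0 : 0 <= (M - n)%:R * theta by rewrite mulr_ge0// ltW.
(* The plateau has length s - e, and e < n theta makes it longer than the (M - n) theta to be
   subtracted. *)
pose e := Num.min d (n%:R * theta / 2).
have e0 : 0 < e by rewrite lt_min d0 divr_gt0.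
have en : e <= n%:R * theta / 2 by rewrite ge_min lexx orbT.
have ed : e <= d by rewrite ge_min lexx.
have es : e <= s by lra.
have dse : d + s + e < 1 by lra.
have [f1 [g1 [h1 _ i1 v1 [x _ gx]]]] := rieffel_basic d0 e0 es dse.
have a0 : 0 <= d + e by lra.
have ar : d + e + (M - n)%:R * theta < d + s by lra.
have b1 : d + s <= 1 by lra.
have [f2 [g2 [h2 v2 i2]]] := rieffel_multi t0 a0 ar b1.
exists f1, g1, f2, g2, (-1), 1; split=> //; [|by right|by split; [rewrite i1 i2 mulN1r; lra|exists x]].
move=> y; have [h|h] := leP (fracr y) (d + e); first by left; apply: v2; left.
have [h'|h'] := leP (d + s) (fracr y); first by left; apply: v2; right.
by right; apply: v1; rewrite !ltW.
Qed.

End RieffelChoice.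

Theorem theorem1 (R : realType) (theta : R) (A : cstarAlgType R) (U V : A)
    (M n : nat)
    (theta_irr : irrational theta) (theta01 : 0 <= theta < 1)
    (torusA : is_nctorus theta U V)
    (M_ge1 : (1 <= M)%N)
    (n_range : (1 <= n <= (M * M.+1)./2)%N)
    (theta_lt : 0 < theta < (maxn n M)%:R^-1) :
  (exists p : A,
     [/\ projection_of_order U V M p,
         torus_trace U V p = ((n%:R * theta)%:C)%C
       & represents_K0 U V (n%:R * theta) p]) /\
  (exists p : A,
     [/\ projection_of_order U V M p,
         torus_trace U V p = ((1 - n%:R * theta)%:C)%C
       & represents_K0 U V (1 - n%:R * theta) p]).
Proof.
have hrel := torusA.1; have n_ge1 : (1 <= n)%N by case/andP: n_range.
have hV : unitary V by case: hrel.
have [f1 [g1 [f2 [g2 [e [c [h1 h2 act ec [tr [x0 gx0]]]]]]]]] :=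
  rieffel_choice M_ge1 n_ge1 theta_lt.
have h2' : rieffel (1%:Z%:~R * theta) f2 g2 by rewrite mul1r.
have act' : acts_on c (M%:Z%:~R * theta) f1 g1 (1%:Z%:~R * theta) f2 g2 by rewrite mul1r.
have [sf1 sg1 _ _ _] := h1; have [sf2 sg2 _ _ _] := h2.
pose p := rief U V M f1 g1 + rc e *: rief U V 1 f2 g2.
have pp : projection p.
  apply: (projectionP _ _ _ _ _ ec); [exact: (rief_star hrel)|exact: (rief_idem hrel)|
    exact: (rief_star hrel)|exact: (rief_idem hrel)|exact: (rief_absorb hrel)].
pose p_ m x := rsym theta M f1 g1 m x + e * rsym theta 1 f2 g2 m x.
have s1 m : smper (rsym theta M f1 g1 m) by exact: smper_rsym.
have s2 m : smper (rsym theta 1 f2 g2 m) by exact: smper_rsym.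
have s2' m : smper (fun x => e * rsym theta 1 f2 g2 m x) by exact: smperM (smper_cst e) (s2 m).
have sp m : smper (p_ m) := smperD (s1 m) (s2' m).
have pE : p = symbol_sum U V M p_.
  have d := symbol_sumD hrel M s1 s2'; have z := symbol_sumZ hrel M e s2.
  have r1 := symbol_sum_rsym (k := M) hrel sf1 sg1 (leqnn M).
  have r2 := symbol_sum_rsym (k := 1) hrel sf2 sg2 M_ge1.
  by rewrite /p -r1 -r2 -z -d.
have MN0 : (M%:Z == 0) = false by apply/eqP; lia.
have N0M : (0 == M%:Z) = false by apply/eqP; lia.
have N0M' : (0 == - M%:Z) = false by apply/eqP; lia.
have MNM : (M%:Z == - M%:Z) = false by apply/eqP; lia.
have MN1 : (M%:Z == - 1%:Z) = false by apply/eqP; lia.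
have N01 : (0 == 1%:Z) = false by [].
have N0N1 : (0 == - 1%:Z) = false by [].
have pM : p_ M x0 = g1 x0.
  (* For M = 1 the second summand also contributes to the coefficient of U^M; it vanishes wherever
     g1 does not. *)
  have g20 : g2 x0 = 0.
    by case: (act x0) => [[_ ->]//|[_ g10 _]]; rewrite g10 eqxx in gx0.
  by rewrite /p_ /rsym /monosym MN0 MNM MN1 eqxx g20 /= !mul0r !mulr0 mul1r !addr0 mulr0 addr0 add0r.
have p0 : p_ 0 = fun x => f1 x + e * f2 x.
  by apply/funext => x; rewrite /p_ /rsym /monosym eqxx N0M N0M' N01 N0N1; rewrite /= !mul1r !mul0r !addr0.
have I0 : I01 (p_ 0) = n%:R * theta.
  have se := smperM (smper_cst e) sf2.
  rewrite p0 I01D; [|exact: (smper_continuous sf1)|exact: (smper_continuous se)].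
  by rewrite I01Z ?tr//; exact: (smper_continuous sf2).
split.
  by exists p; apply: (symbol_projection hrel theta_irr sp) => //; exists x0; rewrite pM.
(* The symbol of 1 - p: since M >= 1, the unit only changes the coefficient of U^0, and that of U^M
   is minus the previous one. *)
pose q_ m x := monosym 0 (fun _ : R => 1) m x + (-1) * p_ m x.
have so m : smper (monosym 0 (fun _ : R => 1) m) by exact: smper_monosym (smper_cst 1).
have spN m : smper (fun x => (-1) * p_ m x) := smperM (smper_cst (-1)) (sp m).
have sq m : smper (q_ m) := smperD (so m) (spN m).
exists (1 - p); apply: (symbol_projection (p_ := q_) hrel theta_irr sq).
- have d := symbol_sumD hrel M so spN; have z := symbol_sumZ hrel M (-1) sp.
  have m0 : 0 \in zrange M by rewrite mem_zrange; apply/andP; split; lia.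
  have o := symbol_sum_mono hrel (smper_cst (1 : R)) m0.
  by rewrite /q_ d z o (fcal1 hV) -pE rcN rc1 scaleN1r mulr1.
- case: pp => sP pP; split; first by rewrite starD starN star1 sP.
  by rewrite mulrBl mul1r mulrBr mulr1 pP subrr subr0.
- by exists x0; rewrite /q_ /monosym MN0 mul0r add0r pM mulN1r oppr_eq0.
- rewrite /q_ I01D; [|exact: (smper_continuous (so 0))|exact: (smper_continuous (spN 0))].
  rewrite (I01Z (-1) (smper_continuous (sp 0))) I0.
  rewrite /monosym eqxx; under eq_fun do rewrite mul1r.
  by rewrite I01_cst mulN1r.
Qed.
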